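(* Let $N\ge 2$, $1\le i\le N-1$, let $\nu\in \mathrm{SYD}(N,n)$, and let $x=(\nu^{(1)},\dots,\nu^{(i-1)},\nu^{(i)},\nu^{(i+1)},\dots,\nu^{(N)}=\nu)\in \mathrm{SSSYT}(\nu,N)$. Write $\tau_i^{bk}(x)=(\nu^{(1)},\dots,\nu^{(i-1)},\tilde\nu^{(i)},\nu^{(i+1)},\dots,\nu^{(N)})$. If $\tau_i^{bk}(x)\in \mathrm{SSSYT}(\nu,N)$ (equivalently $\tilde\nu^{(i)}\in\mathrm{SYD}(i,n)$), then $\tau_i(x)=\tau_i^{bk}(x)$.
   Context: Crystals. Let $\mathfrak g$ be a complex semisimple Lie algebra with index set $I$ of simple roots $\alpha_i$, simple coroots $\alpha_i^\vee$, weight lattice $P$ and dominant weights $P_+$. A (normal) crystal is a set $B$ with maps $\mathrm{wt}:B\to P$, $\tilde e_i,\tilde f_i:B\to B\sqcup\{0\}$ ($i\in I$) with $\tilde e_i b=b'\iff \tilde f_i b'=b$, $\mathrm{wt}(\tilde e_ib)=\mathrm{wt}(b)+\alpha_i$, $\varepsilon_i(b)=\max\{k:\tilde e_i^kb\ne0\}$, $\varphi_i(b)=\max\{k:\tilde f_i^kb\neq 0\}$, $\varphi_i(b)-\varepsilon_i(b)=\langle \mathrm{wt}(b),\alpha_i^\vee\rangle$. We work in the category of crystals each of whose connected components is isomorphic to the Kashiwara crystal $B_\lambda$ ($\lambda\in P_+$) of the irreducible highest weight $U_q(\mathfrak g)$-module $V_\lambda$. Tensor product: $B\otimes B'=\{b\otimes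 b'\}$, $\mathrm{wt}(b\otimes b')=\mathrm{wt}\, b+\mathrm{wt}\, b'$, $\tilde e_i(b\otimes b')=b\otimes\tilde e_ib'$ if $\varepsilon_i(b')>\varphi_i(b)$ and $\tilde e_ib\otimes b'$ otherwise; $\tilde f_i(b\otimes b')=b\otimes \tilde f_ib'$ if $\varepsilon_i(b')\ge\varphi_i(b)$ and $\tilde f_ib\otimes b'$ otherwise (with $b\otimes 0=0\otimes b'=0$); it is associative. An element $b$ is a highest weight element if $\tilde e_ib=0$ for all $i$. Commutor and cactus action. For a crystal $A$, the Schützenberger involution $\xi_A$ is defined on each component $B_\lambda$ as the unique map sending the highest weight element to the lowest weight element and satisfying $\xi(\tilde f_ib)=\tilde e_{\theta(i)}\xi(b)$, $\xi(\tilde e_ib)=\tilde f_{\theta(i)}\xi(b)$, where $\theta:I\to I$ is given by $w_0\alpha_i=-\alpha_{\theta(i)}$. The Henriques–Kamnitzer commutor is $\sigma_{A,B}:A\otimes B\to B\otimes A$, $a\otimes b\mapsto \xi_{B\otimes A}(\xi_B(b)\otimes\xi_A(a))$; it is a crystal isomorphism. For a crystal $B$ and $1\le p\le r<q\le N$ let $\sigma_{p,r,q}=1_{B^{\otimes(p-1)}}\otimes\sigma_{B^{\otimes(r-p+1)},B^{\otimes(q-r)}}\otimes 1_{B^{\otimes(N-q)}}$ acting on $B^{\otimes N}$; set $s_{p,p+1}=\sigma_{p,p,p+1}$, $s_{p,q}=\sigma_{p,p,q}\circ s_{p+1,q}$ for $q-p>1$, and $s_{p,p}=1$. The Bender–Knuth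 generators $\mathbf t_i$ ($1\le i\le N-1$) of the cactus group $C_N$ act on $B^{\otimes N}$ by $T_1=s_{1,2}$, $T_2=s_{1,2}\circ s_{1,3}\circ s_{1,2}$, $T_i=s_{1,i}\circ s_{1,i+1}\circ s_{1,i}\circ s_{1,i-1}$ for $i>2$. Spinor crystal. Take $\mathfrak g$ of type $D_n$ with orthonormal basis $\epsilon_1,\dots,\epsilon_n$, weights written $(\lambda_1,\dots,\lambda_n)=\sum\lambda_j\epsilon_j$, simple roots $\alpha_j=\epsilon_j-\epsilon_{j+1}$ ($j<n$), $\alpha_n=\epsilon_{n-1}+\epsilon_n$; so $\langle\lambda,\alpha_j^\vee\rangle=\lambda_j-\lambda_{j+1}$ ($j<n$), $\langle\lambda,\alpha_n^\vee\rangle=\lambda_{n-1}+\lambda_n$, and $P_+=\{\lambda:\lambda_j\in\frac12\mathbb Z,\lambda_j-\lambda_k\in\mathbb Z,\lambda_1\ge\dots\ge\lambda_n,\lambda_{n-1}+\lambda_n\ge0\}$. The spinor crystal $B_S$ is the set of sign vectors $(i_1,\dots,i_n)$, $i_j=\pm$, with $\mathrm{wt}=\frac12\sum i_j\epsilon_j$; for $j<n$, $\tilde f_j$ changes $(i_j,i_{j+1})=(+,-)$ to $(-,+)$ and is $0$ otherwise, $\tilde e_j$ does the reverse; $\tilde f_n$ changes $(i_{n-1},i_n)=(+,+)$ to $(-,-)$ and is $0$ otherwise, $\tilde e_n$ does the reverse. $P[S]=\{(\pm\frac12,\dots,\pm\frac12)\}$ and $b_\mu$ denotes the unique element of $B_S$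 of weight $\mu$. Let $T^N$ be the set of $(\mu_1,\dots,\mu_N)\in P[S]^N$ with $\mu_1+\dots+\mu_k\in P_+$ for all $k$, and $T^N_\lambda$ those with $\sum\mu_k=\lambda$. The highest weight elements of $B_S^{\otimes N}$ of weight $\lambda$ are exactly the $b_{\mu_1}\otimes\cdots\otimes b_{\mu_N}$ with $(\mu_k)\in T^N_\lambda$. Short tableaux. $\mathrm{SYD}(k,n)$ is the set of Young diagrams with at most $n$ columns whose first two columns have total length $\le k$. For $\nu\in\mathrm{SYD}(N,n)$, $\mathrm{SSSYT}(\nu,N)$ is the set of sequences $(\nu^{(1)},\dots,\nu^{(N)}=\nu)$ with $\nu^{(k)}\in\mathrm{SYD}(k,n)$, $\nu^{(k)}\subset\nu^{(k+1)}$ and $\nu^{(k+1)}\setminus\nu^{(k)}$ a horizontal strip; it is identified with a semistandard tableau of shape $\nu$ whose cells in $\nu^{(k)}\setminus\nu^{(k-1)}$ ($\nu^{(0)}=\emptyset$) contain $k$. To $(\mu_k)\in T^N$ attach $\nu^{(k)}$: with $\gamma=\mu_1+\dots+\mu_k$, $l_j=k/2-\gamma_j$, $r_j=k/2+\gamma_j$, $\nu^{(k)}$ is the Young diagram with column lengths (left to right) $(l_n,l_{n-1},\dots,l_1)$ if $n$ is even and $(r_n,l_{n-1},\dots,l_1)$ if $n$ is odd. This gives a bijection from $T^N_\lambda$ onto $\mathrm{SSSYT}(\nu,N)$, $\nu$ being the diagram attached to $\lambda$ with $k=N$. Define $\tau_i:\mathrm{SSSYT}(\nu,N)\to\mathrm{SSSYT}(\nu,N)$: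 if $x$ corresponds to $(\mu_k)$ and $T_i(b_{\mu_1}\otimes\cdots\otimes b_{\mu_N})=b_{\mu'_1}\otimes\cdots\otimes b_{\mu'_N}$ (with $B=B_S$), then $\tau_i(x)$ corresponds to $(\mu'_k)\in T^N_\lambda$. Bender–Knuth involution $\tau_i^{bk}$ on semistandard tableaux: in the skew tableau formed by the entries $i,i+1$, a cell is free if no other cell of this skew tableau lies in its column; each row consists of non-free $i$'s, then $b$ free $i$'s, then $c$ free $i+1$'s, then non-free $i+1$'s; $\tau_i^{bk}$ replaces in each row the free part by $c$ entries $i$ followed by $b$ entries $i+1$, leaving everything else unchanged. *)

(* Defs.v *)
From mathcomp Require Import all_boot all_order all_algebra.
From Stdlib Require Import ClassicalEpsilon.
Set Implicit Arguments. Unset Strict Implicit. Unset Printing Implicit Defensive.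
Import Order.TTheory GRing.Theory Num.Theory.

(* Conventions.  Type D_n, n >= 2.  Indices of simple roots are 0-based:     *)
(* i = 0 .. n-1 stands for the paper's i+1.  Coordinates eps_j likewise      *)
(* 0-based.  A spinor element (i_1,...,i_n) is a [seq bool] of size n,       *)
(* [true] = '+' and [false] = '-'.  An element b_1 (x) ... (x) b_m of         *)
(* B_S^{(x)m} is the word [:: b_1; ...; b_m] (right-nested bracketing         *)
(* b_1 (x) (b_2 (x) (...)), legitimate by associativity).                     *)

Definition spin := seq bool.
Definition word := seq spin.

(* number of successive applications of a partial map, capped by fuel:
   used for epsilon_i = max{k : e_i^k b <> 0}, phi_i likewise *)
Fixpoint cnt (X : Type) (g : X -> option X) (fuel : nat) (x : X) : nat :=
  match fuel with
  | 0 => 0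
  | k.+1 => match g x with Some y => (cnt g k y).+1 | None => 0 end
  end.

Definition fS (n i : nat) (s : spin) : option spin :=
  if i.+1 < n then
    (if nth false s i && ~~ nth false s i.+1
     then Some (set_nth false (set_nth false s i false) i.+1 true) else None)
  else if i.+1 == n then
    (if nth false s (n - 2) && nth false s (n - 1)
     then Some (set_nth false (set_nth false s (n - 2) false) (n - 1) false)
     else None)
  else None.

Definition eS (n i : nat) (s : spin) : option spin :=
  if i.+1 < n then
    (if ~~ nth false s i && nth false s i.+1
     then Some (set_nth false (set_nth false s i true) i.+1 false) else None)
  else if i.+1 == n then
    (if ~~ nth false s (n - 2) && ~~ nth false s (n - 1)
     then Some (set_nth false (set_nth false s (n - 2) true) (n - 1) true)
     else None)
  else None.

Definition phiS (n i : nat) (s : spin) : nat := cnt (fS n i) 2 s.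

(* Kashiwara operators on words of length m (tensor product rule):
   e_i(b (x) u) = b (x) e_i u  if eps_i(u) > phi_i(b), e_i b (x) u otherwise;
   f_i(b (x) u) = b (x) f_i u  if eps_i(u) >= phi_i(b), f_i b (x) u otherwise.
   eps_i on B_S^{(x)m'} is at most m', so fuel m'.+1 computes it exactly. *)
Fixpoint eW (n m i : nat) (w : word) {struct m} : option word :=
  match m with
  | 0 => None
  | m'.+1 =>
    match w with
    | [::] => None
    | b :: u =>
      if phiS n i b < cnt (eW n m' i) m'.+1 u
      then omap (cons b) (eW n m' i u)
      else omap (fun b' => b' :: u) (eS n i b)
    end
  end.

Fixpoint fW (n m i : nat) (w : word) {struct m} : option word :=
  match m with
  | 0 => None
  | m'.+1 =>
    match w with
    | [::] => None
    | b :: u =>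
      if phiS n i b <= cnt (eW n m' i) m'.+1 u
      then omap (cons b) (fW n m' i u)
      else omap (fun b' => b' :: u) (fS n i b)
    end
  end.

Definition eWord (n i : nat) (w : word) := eW n (size w) i w.
Definition fWord (n i : nat) (w : word) := fW n (size w) i w.

Definition valid_word (n m : nat) (w : word) : bool :=
  (size w == m) && all (fun s => size s == n) w.

Definition highest (n : nat) (w : word) : bool :=
  all (fun i => eWord n i w == None) (iota 0 n).
Definition lowest (n : nat) (w : word) : bool :=
  all (fun i => fWord n i w == None) (iota 0 n).

Definition applyOps (op : nat -> word -> option word) (ws : seq nat) (h : word)
  : option word := foldr (fun i acc => obind (op i) acc) (Some h) ws.

(* theta : w_0 alpha_i = - alpha_theta(i); for D_n it is the identity if n is
   even and swaps the last two nodes if n is odd (0-based: n-2, n-1). *)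
Definition theta (n i : nat) : nat :=
  if odd n then (if i == n - 2 then n - 1 else if i == n - 1 then n - 2 else i)
  else i.

(* Schuetzenberger involution on B_S^{(x)m}, m = size b: on the component
   generated by a highest weight element h (the component is B_lambda, every
   element is f_{i_1}...f_{i_k} h), with lowest weight element l of that
   component, xi(f_{i_1}...f_{i_k} h) = e_{theta i_1}...e_{theta i_k} l. *)
Definition xi_spec (n : nat) (b b' : word) : Prop :=
  exists (ws ws' : seq nat) (h l : word),
    [/\ valid_word n (size b) h && highest n h,
        applyOps (fWord n) ws h = Some b,
        applyOps (fWord n) ws' h = Some l, lowest n l &
        applyOps (eWord n) (map (theta n) ws) l = Some b'].

Definition xi (n : nat) (b : word) : word :=
  epsilon (inhabits b) (xi_spec n b).

(* Henriques--Kamnitzer commutor sigma_{A,B}(a (x) b) = xi_{B(x)A}(xi_B b (x) xi_A a) *)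
Definition comm (n : nat) (a b : word) : word := xi n (xi n b ++ xi n a).

(* sigma_{p,r,q} acting on B^{(x)N}, positions 1-based *)
Definition sigma3 (n p r q : nat) (w : word) : word :=
  let pre := take p.-1 w in
  let mid := take (q - p.-1) (drop p.-1 w) in
  let post := drop q w in
  pre ++ comm n (take (r - p.-1) mid) (drop (r - p.-1) mid) ++ post.

Fixpoint sgen (n p d : nat) : word -> word :=
  match d with
  | 0 => id
  | d'.+1 => sigma3 n p p (p + d) \o sgen n p.+1 d'
  end.

Definition s (n p q : nat) : word -> word := sgen n p (q - p).

(* Action of the Bender--Knuth generator t_i of the cactus group *)
Definition T (n i : nat) : word -> word :=
  if i == 1 then s n 1 2
  else if i == 2 then s n 1 2 \o s n 1 3 \o s n 1 2
  else s n 1 i \o s n 1 i.+1 \o s n 1 i \o s n 1 i.-1.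

(* doubled weight coordinate j of a prefix: 2 gamma_j *)
Definition plusc (p : word) (j : nat) : nat := count (fun s => nth false s j) p.
Definition minusc (p : word) (j : nat) : nat := count (fun s => ~~ nth false s j) p.
Definition gamma2 (p : word) (j : nat) : int := (plusc p j)%:Z - (minusc p j)%:Z.

(* gamma in P_+  (half-integrality conditions are automatic) *)
Definition dominant2 (n : nat) (p : word) : bool :=
  all (fun j => gamma2 p j.+1 <= gamma2 p j)%R (iota 0 n.-1) &&
  (0 <= gamma2 p (n - 2) + gamma2 p (n - 1))%R.

(* T^N, viewed as words b_{mu_1} ... b_{mu_N} *)
Definition TN (n N : nat) (w : word) : bool :=
  valid_word n N w && all (fun k => dominant2 n (take k w)) (iota 1 N).

(* Young diagrams with at most n columns: column lengths, left to right,
   padded with zeros to length n *)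
Definition diagram := seq nat.

Definition SYD (k n : nat) (nu : diagram) : bool :=
  [&& size nu == n,
      all (fun c => nth 0 nu c.+1 <= nth 0 nu c) (iota 0 n.-1) &
      nth 0 nu 0 + nth 0 nu 1 <= k].

Definition hstrip (n : nat) (mu la : diagram) : bool :=
  all (fun c => nth 0 mu c <= nth 0 la c <= (nth 0 mu c).+1) (iota 0 n).

Definition SSSYT (n : nat) (nu : diagram) (N : nat) (x : seq diagram) : bool :=
  [&& size x == N,
      all (fun k => SYD k.+1 n (nth [::] x k)) (iota 0 N),
      all (fun k => hstrip n (nth [::] x k) (nth [::] x k.+1)) (iota 0 N.-1) &
      nth [::] x N.-1 == nu].

(* the diagram nu^(k) attached to a prefix of length k:
   l_j = k/2 - gamma_j = number of '-' at coordinate j,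
   r_j = k/2 + gamma_j = number of '+' at coordinate j;
   columns (l_n, ..., l_1) (n even) or (r_n, l_{n-1}, ..., l_1) (n odd) *)
Definition diag_of (n : nat) (p : word) : diagram :=
  [seq (if odd n && (j == n.-1) then plusc p j else minusc p j)
  | j <- rev (iota 0 n)].

Definition tab (n : nat) (w : word) : seq diagram :=
  [seq diag_of n (take k w) | k <- iota 1 (size w)].

(* Bender--Knuth involution tau_i^bk on x : seq diagram (identified with a
   semistandard tableau of shape nu = last diagram).  Rows/columns 0-based. *)
Section BK.
Variables (n i : nat) (x : seq diagram).
Let nu := nth [::] x (size x).-1.
(* entry of the cell (r,c): the k with (r,c) in nu^(k) \ nu^(k-1) *)
Definition entry (r c : nat) : nat := (count (fun d => nth 0 d c <= r) x).+1.
Definition in_skew (r c : nat) : bool :=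
  (r < nth 0 nu c) && ((entry r c == i) || (entry r c == i.+1)).
Definition free (r c : nat) : bool :=
  in_skew r c &&
  ~~ has (fun r' => (r' != r) && in_skew r' c) (iota 0 (nth 0 nu c)).
Definition new_entry (r c : nat) : nat :=
  if free r c then
    let fc := [seq c' <- iota 0 n | free r c'] in
    let nc := count (fun c' => entry r c' == i.+1) fc in
    if index c fc < nc then i else i.+1
  else entry r c.
Definition new_diag : diagram :=
  [seq count (fun r => new_entry r c <= i) (iota 0 (nth 0 nu c)) | c <- iota 0 n].
Definition bk : seq diagram := set_nth [::] x i.-1 new_diag.
End BK.

(* Main.v *)
Require Import Defs.
From mathcomp Require Import all_boot all_order all_algebra zify.
From Stdlib Require Import ClassicalEpsilon.
Set Implicit Arguments. Unset Strict Implicit. Unset Printing Implicit Defensive.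
Import Order.TTheory GRing.Theory Num.Theory.

(* Words are lattice paths: [hgt i w k] is the pairing of the weight of the
   first [k] letters with the [i]-th coroot, and [e_i] flips the letter at which
   [hgt i w] first reaches its minimum.  Reading Stembridge's local axioms off
   these paths shows that a component is determined by its highest weight, so the
   Schuetzenberger involution xi exists and is unique.  With eta (reversal and
   letterwise duality), [s_{1,k} = xi eta] on the first [k] letters, hence [T_i]
   sends a highest word [u b c] to [top (u' c) c'], where [top u' = u] and
   [b0 u' c] is highest for some letter [b0].  As [b0] is minuscule, [u'] can be
   raised to [u] inside [u' c] without touching [c], so [T_i] replaces [u b] by
   the top [u b~] of the component of [u c].  Raising [u c] along a type A
   subdiagram only sorts column lengths that differ in a single cell, which is
   what the Bender-Knuth involution does to the diagram [nu^(i)]; when the result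
   is short, it is dominant and therefore the top of the component. *)

Local Open Scope ring_scope.

(** * Letters of the spinor crystal *)

(** The involution of the definitions is a choice applied to a relation, so nothing can be computed
    with it before that relation is known to have exactly one solution. The map eta reverses all
    arrows by an explicit formula but may leave the component. An isomorphism can bring it back only
    if both components have the same highest weight; this follows from the invariance of weights
    under w0, obtained by composing reflections along strings. Of [u'] one knows only that it lies
    in the component of [u], so [c] must be carried along while [u'] is raised. This is harmless as
    long as all depths met on the way are at most one, and the letter [b0] in front is used to make
    this bound survive every raising. Sorting along the type A nodes secures every dominance
    condition except one. The remaining node measures the total length of the first two columns, and
    this is the place where the shortness of the new tableau enters. *)

Definition letter (n : nat) := n.-tuple bool.

Section Letters.
Variable n : nat.
Hypothesis n_gt1 : (1 < n)%N.
Implicit Types (b : letter n) (i j : nat) (v : bool).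

Definition bit b j : bool := nth false b j.
(** The weight coordinate is [bitz b j] minus one half. The shift cancels in differences and
    accounts for the [- 1] in [sg] at the last node. *)
Definition bitz b j : int := (nat_of_bool (bit b j))%:Z.
Definition mkletter (f : nat -> bool) : letter n := [tuple of mkseq f n].

(* [sg i b] is the pairing of the weight of [b] with the [i]-th coroot,
   [sroot i] the [i]-th simple root and [cart i j] the pairing of [sroot i] with
   the [j]-th coroot. *)
Definition sg i b : int :=
  if (i.+1 < n)%N then bitz b i - bitz b i.+1
  else if i.+1 == n then bitz b (n - 2) + bitz b (n - 1) - 1 else 0.

Definition sroot i j : int :=
  if (i.+1 < n)%N then (j == i)%:Z - (j == i.+1)%:Z
  else if i.+1 == n then (j == n - 2)%N%:Z + (j == n - 1)%N%:Z else 0.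

Definition cart i j : int :=
  if (j.+1 < n)%N then sroot i j - sroot i j.+1
  else if j.+1 == n then sroot i (n - 2) + sroot i (n - 1) else 0.

(** [flip true] is the raising and [flip false] the lowering operator where these are nonzero;
    elsewhere the value is a junk letter. Hence the hypothesis [sg i b = (-1) ^+ v] below, which
    treats both operators at once. *)
Definition flip (v : bool) i b : letter n :=
  mkletter (fun j =>
    if (i.+1 < n)%N then
      if j == i then v else if j == i.+1 then ~~ v else bit b j
    else if (j == n - 2)%N || (j == n - 1)%N then v else bit b j).

(* The letter of weight [w0 (wt b)]. *)
Definition dual b : letter n :=
  mkletter (fun j => if odd n && (j == n.-1) then bit b j else ~~ bit b j).

Lemma bit_mk f j : (j < n)%N -> bit (mkletter f) j = f j.
Proof. by move=> jn; rewrite /bit nth_mkseq. Qed.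

Lemma letterP b b' : (forall j, (j < n)%N -> bit b j = bit b' j) -> b = b'.
Proof.
move=> H; apply: val_inj; apply: (@eq_from_nth _ false) => [|j]; rewrite !size_tuple //.
by apply: H.
Qed.

Lemma bitz01 b j : 0 <= bitz b j <= 1.
Proof. by rewrite /bitz; case: (bit b j). Qed.

Lemma sg_bound i b : - 1 <= sg i b <= 1.
Proof.
have := (bitz01 b i, bitz01 b i.+1, bitz01 b (n - 2)%N, bitz01 b (n - 1)%N).
move=> [[[h1 h2] h3] h4].
by rewrite /sg; do ?case: ifP => _; lia.
Qed.

Lemma sg0 i b : (n <= i)%N -> sg i b = 0.
Proof. by move=> h; rewrite /sg; do ?case: ifP => ?; lia. Qed.

Lemma cart2 i : (i < n)%N -> cart i i = 2.
Proof. by rewrite /cart /sroot => h; do ! case: ifP => //; lia. Qed.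

Lemma cart_off i j : (i < n)%N -> (j < n)%N -> i != j ->
  (cart i j = 0 /\ cart j i = 0) \/ (cart i j = -1 /\ cart j i = -1).
Proof.
rewrite /cart /sroot => hi hj ij.
by do ! case: ifP => //; lia.
Qed.

Lemma bitz_flip v i b j : (i < n)%N -> (j < n)%N -> sg i b = (-1) ^+ v ->
  bitz (flip v i b) j = bitz b j + (-1) ^+ v.+1 * sroot i j.
Proof.
move=> hi hj; rewrite /bitz bit_mk // /sg /sroot /bitz.
case: ifP => h1.
  case: (eqVneq j i) => [->|ji]; case: (eqVneq i i.+1) => ?; try lia.
    by case: v; rewrite ?expr1 ?expr0; case: (bit b i); case: (bit b i.+1).
  case: (eqVneq j i.+1) => [->|ji'].
    by case: v; rewrite ?expr1 ?expr0; case: (bit b i); case: (bit b i.+1).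
  by move=> _; rewrite mulr0 addr0.
case: ifP => h2; last by lia.
have ? : (n - 2 != n - 1)%N by lia.
case: (eqVneq j (n-2)%N) => [->|ji]; case: (eqVneq _ (n-1)%N) => [?|ji'] /=; subst; try lia.
- by case: v; case: (bit b (n-2)%N); case: (bit b (n-1)%N).
- by case: v; case: (bit b (n-2)%N); case: (bit b (n-1)%N).
Qed.

Lemma sg_flip v i b j : (i < n)%N -> sg i b = (-1) ^+ v ->
  sg j (flip v i b) = sg j b + (-1) ^+ v.+1 * cart i j.
Proof.
move=> hi h; rewrite /sg /cart; case: ifP => h1.
  rewrite !bitz_flip //; lia.
case: ifP => h2; last by rewrite mulr0 addr0.
rewrite !bitz_flip //; lia.
Qed.

Lemma sg_raise i b j : (i < n)%N -> sg i b = -1 ->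
  sg j (flip true i b) = sg j b + cart i j.
Proof. by move=> hi h; rewrite (@sg_flip true) // sqrrN expr1n mul1r. Qed.

Lemma sg_lower i b j : (i < n)%N -> sg i b = 1 ->
  sg j (flip false i b) = sg j b - cart i j.
Proof. by move=> hi h; rewrite (@sg_flip false) // expr1 mulN1r. Qed.

Lemma bitz_inj b b' j : bitz b j = bitz b' j -> bit b j = bit b' j.
Proof. by rewrite /bitz; case: (bit b j); case: (bit b' j). Qed.

Lemma flipK v i b : (i < n)%N -> sg i b = (-1) ^+ v -> flip (~~ v) i (flip v i b) = b.
Proof.
move=> hi h; apply: letterP => j jn; apply: bitz_inj.
rewrite !bitz_flip // ?sg_flip // ?cart2 //; case: (v) h => /=; rewrite ?expr1 ?expr0 ?expr2; lia.
Qed.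

Lemma flip_flipC v v' i j b : (i < n)%N -> (j < n)%N -> cart i j = 0 -> cart j i = 0 ->
  sg i b = (-1) ^+ v -> sg j b = (-1) ^+ v' ->
  flip v' j (flip v i b) = flip v i (flip v' j b).
Proof.
move=> hi hj cij cji si sj; apply: letterP => k kn; apply: bitz_inj.
rewrite !bitz_flip ?sg_flip ?cij ?cji ?mulr0 ?addr0 //.
by rewrite addrAC.
Qed.

Lemma theta_lt i : (i < n)%N -> (theta n i < n)%N.
Proof. by rewrite /theta; do ! case: ifP => //; lia. Qed.

Lemma thetaK i : theta n (theta n i) = i.
Proof. by rewrite /theta; do ! case: ifP => //; lia. Qed.

Lemma bitz_dual b j : (j < n)%N ->
  bitz (dual b) j = if odd n && (j == n.-1) then bitz b j else 1 - bitz b j.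
Proof. by move=> jn; rewrite /bitz bit_mk //; case: ifP => //; case: (bit b j). Qed.

Lemma dualK b : dual (dual b) = b.
Proof.
apply: letterP => j jn; apply: bitz_inj; rewrite !bitz_dual //.
by case: (odd n && _) => //; rewrite opprB addrC subrK.
Qed.

Lemma sg_dual i b : sg (theta n i) (dual b) = - sg i b.
Proof.
case: (ltnP i n) => hi; last first.
  by rewrite !sg0 // /theta; do ?case: ifP => ?; lia.
have D2 : bitz (dual b) (n - 2) = 1 - bitz b (n - 2).
  by rewrite bitz_dual; last lia; rewrite ifN //; lia.
have D1 : bitz (dual b) (n - 1) = if odd n then bitz b (n - 1) else 1 - bitz b (n - 1).
  by rewrite bitz_dual; last lia; rewrite subn1 eqxx andbT.
have D j : (j < n - 1)%N -> bitz (dual b) j = 1 - bitz b j.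
  by move=> hj; rewrite bitz_dual; last lia; rewrite ifN //; lia.
have e1 : (n - 2).+1 = (n - 1)%N by lia.
have e2 : (n - 1).+1 = n by lia.
have [h|h] := boolP (i.+2 < n)%N.
  have -> : theta n i = i by rewrite /theta; do ?case: ifP => ?; lia.
  by rewrite /sg; do ?case: ifP => ?; try lia; rewrite !D; lia.
have [e|e] : i = (n - 2)%N \/ i = (n - 1)%N by lia.
  rewrite e /theta eqxx; case on: (odd n) D1 => D1.
    by rewrite /sg e1 e2 ltnn eqxx; do ?case: ifP => ?; try lia; rewrite D1 D2; lia.
  by rewrite /sg e1; do ?case: ifP => ?; try lia; rewrite D1 D2; lia.
have e3 : (n - 1 == n - 2)%N = false by lia.
rewrite e /theta e3 eqxx; case on: (odd n) D1 => D1.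
  by rewrite /sg e1 e2 ltnn eqxx; do ?case: ifP => ?; try lia; rewrite D1 D2; lia.
by rewrite /sg e2 ltnn eqxx D1 D2; lia.
Qed.

Lemma dual_flip i b : (i < n)%N -> sg i b = -1 ->
  dual (flip true i b) = flip false (theta n i) (dual b).
Proof.
move=> hi si; apply: letterP => k kn; apply: bitz_inj.
rewrite bitz_dual // !bitz_flip ?theta_lt ?sg_dual ?si ?expr0 ?expr1 // bitz_dual //.
rewrite expr2 /sroot /theta.
by do ! case: ifP => //; lia.
Qed.

End Letters.

(** * Crystal operators on words *)

Section Words.
Variable n : nat.
Hypothesis n_gt1 : (1 < n)%N.
Notation lword := (seq (letter n)).
Implicit Types (w x y z t : lword) (i j k a b c d : nat).

Definition l0 : letter n := mkletter n (fun=> false).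

Definition hgt i w k : int := \sum_(l <- take k w) sg i l.
Definition tot i w : int := \sum_(l <- w) sg i l.

Lemma hgt0 i w : hgt i w 0 = 0.
Proof. by rewrite /hgt take0 big_nil. Qed.

Lemma hgt_size i w : hgt i w (size w) = tot i w.
Proof. by rewrite /hgt take_size. Qed.

Lemma hgtS i w k : (k < size w)%N -> hgt i w k.+1 = hgt i w k + sg i (nth l0 w k).
Proof. by move=> h; rewrite /hgt (take_nth l0 h) -cats1 big_cat big_seq1. Qed.

Lemma hgt_cons i l w k : hgt i (l :: w) k.+1 = sg i l + hgt i w k.
Proof. by rewrite /hgt /= big_cons. Qed.

Definition upd w a (l : letter n) : lword := set_nth l0 w a l.

Lemma size_upd w a l : (a < size w)%N -> size (upd w a l) = size w.
Proof. by rewrite size_set_nth => h; apply/maxn_idPr. Qed.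

Lemma nth_upd w a l k : nth l0 (upd w a l) k = if k == a then l else nth l0 w k.
Proof. by rewrite nth_set_nth. Qed.

Lemma hgt_upd i w a l k : (a < size w)%N -> (k <= size w)%N ->
  hgt i (upd w a l) k = hgt i w k + (if (a < k)%N then sg i l - sg i (nth l0 w a) else 0).
Proof.
move=> aw; elim: k => [|k IH] kw; first by rewrite !hgt0.
rewrite !hgtS ?size_upd // IH ?(ltnW kw) // nth_upd.
by case: (ltngtP a k) => [ak|ka|->]; do ?case: ifP => ?; lia.
Qed.

Lemma upd_upd w a l l' : upd (upd w a l) a l' = upd w a l'.
Proof. by rewrite /upd set_set_nth eqxx. Qed.

Lemma upd_nth w a : (a < size w)%N -> upd w a (nth l0 w a) = w.
Proof.
move=> h; apply: (@eq_from_nth _ l0); first by rewrite size_upd.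
by move=> k _; rewrite nth_upd; case: eqP => // ->.
Qed.

(** The signature rule in path form: [a.+1] is the first minimum of the height path, and the strict
    inequality at [k = 0] makes this minimum negative, so that the operator is nonzero. In [fstep],
    [a] is the last minimum. *)
Definition estep i w a w' :=
  [/\ (a < size w)%N, forall k, (k <= a)%N -> hgt i w a.+1 < hgt i w k,
      forall k, (k <= size w)%N -> hgt i w a.+1 <= hgt i w k &
      w' = upd w a (flip true i (nth l0 w a))].

Definition fstep i w a w' :=
  [/\ (a < size w)%N, forall k, (a < k)%N -> (k <= size w)%N -> hgt i w a < hgt i w k,
      forall k, (k <= size w)%N -> hgt i w a <= hgt i w k &
      w' = upd w a (flip false i (nth l0 w a))].

(* [es i w w'] stands for [e_i w = w'], equivalently [f_i w' = w]. *)
Definition es i w w' := exists a, estep i w a w'.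

Lemma estep_sg i w a w' : estep i w a w' ->
  [/\ (i < n)%N, sg i (nth l0 w a) = -1 & hgt i w a = hgt i w a.+1 + 1].
Proof.
case=> aw /(_ a (leqnn a)) h1 _ _; move: (hgtS i aw) => h2.
have := sg_bound n_gt1 i (nth l0 w a).
case: (ltnP i n) => h; last by move: h1; rewrite h2 sg0 //; lia.
by split=> //; lia.
Qed.

Lemma estep_hgt i w a w' : estep i w a w' -> size w' = size w /\
  forall j k, (k <= size w)%N ->
    hgt j w' k = hgt j w k + (if (a < k)%N then cart n i j else 0).
Proof.
move=> E; have [hi si _] := estep_sg E; case: E => aw _ _ ->.
split=> [|j k kw]; first by rewrite size_upd.
rewrite hgt_upd // (sg_raise n_gt1) //.
by case: ifP => _; lia.
Qed.

Lemma fstep_sg i w a w' : fstep i w a w' ->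
  [/\ (i < n)%N, sg i (nth l0 w a) = 1 & hgt i w a = hgt i w a.+1 - 1].
Proof.
case=> aw /(_ a.+1 (leqnn _) aw) h1 _ _; move: (hgtS i aw) => h2.
have := sg_bound n_gt1 i (nth l0 w a).
case: (ltnP i n) => h; last by move: h1; rewrite h2 sg0 //; lia.
by split=> //; lia.
Qed.

Lemma estep_fstep i w a w' : estep i w a w' -> fstep i w' a w.
Proof.
move=> E; have [hi si ha] := estep_sg E; have [sz H] := estep_hgt E.
case: E => aw h1 h2 e; have c2 := cart2 n_gt1 hi.
split.
- by rewrite sz.
- move=> k ak; rewrite sz => kw; rewrite !H ?ltnn ?ak ?c2; try lia.
  by have := h2 k kw; lia.
- move=> k; rewrite sz => kw; rewrite !H ?ltnn ?c2; try lia.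
  case: ifP => [ak|/negbT]; first by have := h2 k kw; lia.
  by rewrite -leqNgt => ak; have := h1 k ak; lia.
by rewrite e upd_upd nth_upd eqxx (@flipK _ n_gt1 true) ?expr1 // upd_nth.
Qed.

Lemma fstep_estep i w a w' : fstep i w a w' -> estep i w' a w.
Proof.
move=> E; have [hi si ha] := fstep_sg E.
case: E => aw h1 h2 ->; have c2 := cart2 n_gt1 hi.
have H k : (k <= size w)%N -> hgt i (upd w a (flip false i (nth l0 w a))) k =
  hgt i w k - (if (a < k)%N then 2 else 0).
  move=> kw; rewrite hgt_upd // (sg_lower n_gt1) // c2.
  by case: ifP => _; lia.
split.
- by rewrite size_upd.
- move=> k ak; rewrite !H ?leqnn ?leqnSn; try lia.
  by have := h2 k; case: ifP; lia.
- move=> k; rewrite size_upd // => kw; rewrite !H ?leqnn; try lia.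
  have := h2 k kw; case: ifP => [ak|_]; last by lia.
  by have := h1 k ak kw; lia.
by rewrite upd_upd nth_upd eqxx (@flipK _ n_gt1 false) ?expr0 // upd_nth.
Qed.

Lemma es_det i w w1 w2 : es i w w1 -> es i w w2 -> w1 = w2.
Proof.
move=> [a [aw h1 h2 e]] [b [bw h3 h4 e']].
suff : a = b by move=> ab; rewrite e e' ab.
by case: (ltngtP a b) => // ab; [have := h3 _ ab; have := h2 b.+1 bw|have := h1 _ ab; have := h4 a.+1 aw]; lia.
Qed.

Lemma es_inj i w w1 w2 : es i w1 w -> es i w2 w -> w1 = w2.
Proof.
move=> [a /estep_fstep[aw h1 h2 e]] [b /estep_fstep[bw h3 h4 e']].
suff : a = b by move=> ab; rewrite e e' ab.
case: (ltngtP a b) => // ab; [have := h1 _ ab (ltnW bw); have := h4 a|have := h3 _ ab (ltnW aw); have := h2 b]; lia.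
Qed.

Lemma es_lt i w w' : es i w w' -> (i < n)%N.
Proof. by case=> a /estep_sg[]. Qed.

Lemma es_size i w w' : es i w w' -> size w' = size w.
Proof. by case=> a /estep_hgt[]. Qed.

Lemma es_tot i j w w' : es i w w' -> tot j w' = tot j w + cart n i j.
Proof.
case=> a E; have [aw _ _ _] := E; have [sz H] := estep_hgt E.
by rewrite -hgt_size sz H // aw hgt_size.
Qed.

(* [dep] and [phi] are the string lengths epsilon_i and varphi_i. *)
Definition dep i w : int := foldr (fun l e => Num.max 0 (e - sg i l)) 0 w.
Definition phi i w : int := dep i w + tot i w.

Lemma dep_hgt i w : (forall k, (k <= size w)%N -> - dep i w <= hgt i w k) /\
  exists2 k, (k <= size w)%N & hgt i w k = - dep i w.
Proof.
elim: w => [|l w [IH1 [k0 kw IH2]]].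
  split=> [k|]; first by rewrite /hgt big_nil.
  by exists 0%N => //; rewrite hgt0.
rewrite [dep _ _]/= -/(dep i w); split=> [[|k] kw'|].
- by rewrite hgt0; lia.
- by rewrite hgt_cons; have := IH1 k kw'; lia.
have [h|h] := leP 0 (dep i w - sg i l).
  by exists k0.+1 => //; rewrite hgt_cons IH2; lia.
by exists 0%N => //; rewrite hgt0; lia.
Qed.

Lemma depP i w M : (forall k, (k <= size w)%N -> - M <= hgt i w k) ->
  (exists2 k, (k <= size w)%N & hgt i w k = - M) -> dep i w = M.
Proof.
move=> h1 [k kw h2]; have [h3 [k' kw' h4]] := dep_hgt i w.
by have := h1 k' kw'; have := h3 k kw; lia.
Qed.

Lemma dep_ge0 i w : 0 <= dep i w.
Proof. by have [/(_ 0%N isT)] := dep_hgt i w; rewrite hgt0; lia. Qed.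

Lemma estep_dep i w a w' : estep i w a w' -> dep i w = - hgt i w a.+1.
Proof.
case=> aw h1 h2 _; apply: depP => [k kw|]; first by have := h2 k kw; lia.
by exists a.+1 => //; lia.
Qed.

Lemma es_ex i w : 0 < dep i w -> exists w', es i w w'.
Proof.
move=> d0; have [h1 [k kw h2]] := dep_hgt i w.
have ex : exists k, (k <= size w)%N && (hgt i w k == - dep i w).
  by exists k; rewrite kw h2 eqxx.
case: (ex_minnP ex) => [[|a] /andP[aw /eqP e] mn]; first by move: e; rewrite hgt0; lia.
exists (upd w a (flip true i (nth l0 w a))), a; split=> // [k' ka|k' kw']; last first.
  by rewrite e; apply: h1.
have kw' : (k' <= size w)%N by lia.
have := h1 k' kw'; rewrite e; case: (eqVneq (hgt i w k') (- dep i w)) => [e'|]; last by lia.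
by have := mn k'; rewrite kw' e' eqxx => /(_ isT); lia.
Qed.

Lemma phi_hgt i w : (forall k, (k <= size w)%N -> tot i w - hgt i w k <= phi i w) /\
  exists2 k, (k <= size w)%N & tot i w - hgt i w k = phi i w.
Proof.
have [h1 [k kw h2]] := dep_hgt i w; rewrite /phi; split=> [k' kw'|].
  by have := h1 k' kw'; lia.
by exists k => //; lia.
Qed.

Lemma phi_ge0 i w : 0 <= phi i w.
Proof. by have [/(_ _ (leqnn _))] := phi_hgt i w; rewrite hgt_size; lia. Qed.

Lemma fs_ex i w : 0 < phi i w -> exists w', es i w' w.
Proof.
rewrite /phi => d0; have [h1 [k kw h2]] := dep_hgt i w.
have ex : exists k, (k <= size w)%N && (hgt i w k == - dep i w).
  by exists k; rewrite kw h2 eqxx.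
have ub k' : (k' <= size w)%N && (hgt i w k' == - dep i w) -> (k' <= size w)%N.
  by case/andP.
case: (ex_maxnP ex ub) => a /andP[aw /eqP e] mx.
have aw' : (a < size w)%N.
  rewrite ltn_neqAle aw andbT; apply/eqP => ea; move: e; rewrite ea hgt_size; lia.
exists (upd w a (flip false i (nth l0 w a))), a; apply: fstep_estep; split=> // k' ka.
  move=> kw'; have := h1 k' kw'; rewrite e.
  case: (eqVneq (hgt i w k') (- dep i w)) => [e'|]; last by lia.
  by have := mx k'; rewrite kw' e' eqxx => /(_ isT); lia.
by rewrite e; apply: h1.
Qed.

Lemma es_dep i w w' : es i w w' -> dep i w' = dep i w - 1.
Proof.
case=> a E; have [sz H] := estep_hgt E; have [hi _ ha] := estep_sg E.
have c2 := cart2 n_gt1 hi.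
rewrite (estep_dep E); case: E => aw h1 h2 _; apply: depP.
  move=> k; rewrite sz => kw; rewrite H //; case: ifP => ak; first by have := h2 k kw; lia.
  by have := h1 k; lia.
exists a; first by rewrite sz; lia.
by rewrite H ?ltnn; lia.
Qed.

Lemma es_dep_gt0 i w w' : es i w w' -> 0 < dep i w.
Proof. by move=> h; have := dep_ge0 i w'; rewrite (es_dep h); lia. Qed.

Lemma es_phi i w w' : es i w w' -> phi i w' = phi i w + 1.
Proof.
move=> h; rewrite /phi (es_dep h) (es_tot i h) (cart2 n_gt1 (es_lt h)); lia.
Qed.

Lemma es_phi_gt0 i w w' : es i w w' -> 0 < phi i w'.
Proof. by move=> h; have := phi_ge0 i w; rewrite (es_phi h); lia. Qed.

(** Raising at [a] shifts the part of the [j]-path beyond [a] by the Cartan integer, so the minimum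
    moves by that integer or not at all. *)
Lemma es_dep_other i j w w' : es i w w' -> (j < n)%N -> i != j ->
  (cart n i j = 0 /\ dep j w' = dep j w) \/
  (cart n i j = -1 /\ (dep j w' = dep j w \/ dep j w' = dep j w + 1)).
Proof.
case=> a E jn ij; have [sz H] := estep_hgt E; have [hi _ ha] := estep_sg E.
have [h1 [k1 kw1 e1]] := dep_hgt j w; have [h2 [k2 kw2 e2]] := dep_hgt j w'.
rewrite sz in h2 kw2; move: (h1 k2 kw2) (h2 k1 kw1) e2; rewrite !H //.
by case: (cart_off n_gt1 hi jn ij) => [[-> _]|[-> _]]; do ?case: ifP => ?; lia.
Qed.
End Words.

(** * Local axioms *)

Section Stembridge.
Variable n : nat.
Hypothesis n_gt1 : (1 < n)%N.
Notation lword := (seq (letter n)).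
Implicit Types (w x y z t : lword) (i j k a b c d : nat).
Notation nthl := (nth (l0 n)).

Definition raise i w a : lword := upd w a (flip true i (nthl w a)).

Lemma estep_intro i w a : (a < size w)%N ->
  (forall k, (k <= a)%N -> hgt i w a.+1 < hgt i w k) ->
  (forall k, (k <= size w)%N -> hgt i w a.+1 <= hgt i w k) ->
  estep i w a (raise i w a).
Proof. by []. Qed.

Lemma es_square0 i j x y z : es i x y -> es j x z -> i != j -> cart n i j = 0 ->
  exists t, es j y t /\ es i z t.
Proof.
move=> [a E] [b E'] ij c0.
have [hi si ha] := estep_sg n_gt1 E; have [hj sj hb] := estep_sg n_gt1 E'.
have c0' : cart n j i = 0 by case: (cart_off n_gt1 hi hj ij); lia.
have [sy Hy] := estep_hgt n_gt1 E; have [sz Hz] := estep_hgt n_gt1 E'.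
have K (w : lword) (p q : nat) : (if (p < q)%N then 0 else 0 : int) = 0 by case: ifP.
case: E => aw h1 h2 ey; case: E' => bw h3 h4 ez.
exists (raise j y b); split.
  exists b; apply: estep_intro; rewrite ?sy // => k kw.
    by rewrite !Hy ?c0 ?(K y) ?addr0; try lia; apply: h3.
  by rewrite !Hy ?c0 ?(K y) ?addr0; try lia; apply: h4.
have -> : raise j y b = raise i z a.
  apply: (@eq_from_nth _ (l0 n)).
    by rewrite !size_upd ?ey ?ez ?size_upd.
  move=> k _; rewrite ey ez !nth_upd.
  (* Both operators may act on the same letter; then the two flips of that letter have to
     commute. *)
  case: (eqVneq a b) si sj => [<- si sj|ab _ _].
    by rewrite ?eqxx; case: (eqVneq k a) => // _; apply: (@flip_flipC _ n_gt1 true true).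
  by case: (eqVneq k b) => [->|//]; case: eqVneq ab.
exists a; apply: estep_intro; rewrite ?sz // => k kw.
  by rewrite !Hz ?c0' ?(K y) ?addr0; try lia; apply: h1.
by rewrite !Hz ?c0' ?(K y) ?addr0; try lia; apply: h2.
Qed.

(** The only possible coincidences are [a = c] and [b = d], and there both sides flip the letter in
    the same order. *)
Lemma raise_interleave i j x a b c d : (a <= c)%N -> (c < b)%N -> (b <= d)%N ->
  (d < size x)%N ->
  raise i (raise j (raise j (raise i x a) b) c) d =
  raise j (raise i (raise i (raise j x b) d) a) c.
Proof.
move=> ac cb bd dx; apply: (@eq_from_nth _ (l0 n)).
  by rewrite !size_upd // ?size_upd //; lia.
move=> k _; rewrite !nth_upd.
have -> : (b == a) = false by lia.
have -> : (c == b) = false by lia.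
have -> : (d == c) = false by lia.
have -> : (d == a) = false by lia.
have -> : (a == d) = false by lia.
have -> : (a == b) = false by lia.
have -> : (c == d) = false by lia.
case: (eqVneq k d) => kd; case: (eqVneq k c) => kc; case: (eqVneq k a) => ka;
  case: (eqVneq k b) => kb; case: (eqVneq c a) => ca; case: (eqVneq d b) => db;
  subst => //; lia.
Qed.

(* With adjacent nodes, let [a < b] be the first minima of the two height
   functions.  Raising at [a] always deepens the [j]-minimum.  Raising at [b]
   deepens the [i]-minimum iff this minimum is attained again after [b]; then
   both orders flip the same four letters [a <= c < b <= d], with [c] the first
   place after [a] where the [j]-height is one above its minimum and [d] the
   first place after [b] where the [i]-height is minimal. *)
Lemma es_adjacent i j a b x y z : estep i x a y -> estep j x b z ->
  cart n i j = -1 -> cart n j i = -1 -> (a < b)%N ->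
  dep j y = dep j x + 1 /\
  ((dep i z = dep i x /\ exists t, es j y t /\ es i z t) \/
   (dep i z = dep i x + 1 /\ exists y1 y2 z1 z2 t,
     [/\ es j y y1, es j y1 y2 & es i y2 t] /\
     [/\ es i z z1, es i z1 z2 & es j z2 t] /\
     dep i y2 = dep i x /\ dep j z2 = dep j x)).
Proof.
move=> E E' cij cji ab.
have [hi si ha] := estep_sg n_gt1 E; have [hj sj hb] := estep_sg n_gt1 E'.
have [sy Hy] := estep_hgt n_gt1 E; have [sz Hz] := estep_hgt n_gt1 E'.
have c2 := cart2 n_gt1 hi; have c2' := cart2 n_gt1 hj.
have dx := estep_dep n_gt1 E; have dx' := estep_dep n_gt1 E'.
have [E0 E0'] := (E, E').
case: E0 => aw h1 h2 ey; case: E0' => bw h3 h4 ez.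
have Ey1 : estep j y b (raise j y b).
  apply: estep_intro; rewrite ?sy // => k kw; rewrite !Hy ?cij; try lia.
    by have := h3 k; do ?case: ifP; lia.
  by have := h4 k; do ?case: ifP; lia.
split.
  rewrite (estep_dep n_gt1 Ey1) Hy ?cij; try lia.
  by case: ifP; lia.
have [dz1 [kz kz1 ekz]] := dep_hgt n_gt1 i z; rewrite sz in dz1 kz1.
have [nod|[d0 [d0w e0]]] : (forall d, (b < d <= size x)%N -> hgt i x a.+1 < hgt i x d) \/
   exists d, (b < d <= size x)%N /\ hgt i x a.+1 = hgt i x d.
  case: (excluded_middle_informative (exists d, (b < d <= size x)%N /\ hgt i x a.+1 = hgt i x d)).
    by right.
  move=> ne; left=> d dw; have := h2 d; case: (eqVneq (hgt i x a.+1) (hgt i x d)) => e; last by lia.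
  by case: ne; exists d.
- left; have Ez1 : estep i z a (raise i z a).
    apply: estep_intro; rewrite ?sz // => k kw; rewrite !Hz ?cji; try lia.
      by have := h1 k; do ?case: ifP; lia.
    by have := h2 k; have := nod k; do ?case: ifP; lia.
  split.
    rewrite (estep_dep n_gt1 Ez1) Hz ?cji; try lia.
    by case: ifP; lia.
  exists (raise j y b); split; first by exists b.
  exists a; rewrite (_ : raise j y b = raise i z a) //.
  apply: (@eq_from_nth _ (l0 n)).
    by rewrite !size_upd ?ey ?ez ?size_upd.
  move=> k _; rewrite ey ez !nth_upd; do ?case: eqVneq => ?; subst => //; lia.
right.
have exd : exists d, (b < d <= size x)%N && (hgt i x d == hgt i x a.+1).
  by exists d0; rewrite d0w e0 eqxx.
case: (ex_minnP exd) => [[|d]] // /andP[/andP[bd dw] /eqP ed] mind.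
have mind' k : (b < k)%N -> (k <= d)%N -> hgt i x a.+1 < hgt i x k.
  move=> bk kd; have := h2 k; case: (eqVneq (hgt i x k) (hgt i x a.+1)) => e; last by lia.
  by have := mind k; rewrite e eqxx bk /=; lia.
have exc : exists c, (a < c <= b)%N && (hgt j x c == hgt j x b.+1 + 1).
  by exists b; rewrite ab leqnn hb eqxx.
case: (ex_minnP exc) => [[|c]] // /andP[/andP[ac cb] /eqP ec] minc.
have minc' k : (a < k)%N -> (k <= c)%N -> hgt j x c.+1 < hgt j x k.
  move=> ak kc; have := h3 k; case: (eqVneq (hgt j x k) (hgt j x b.+1 + 1)) => e; last by lia.
  by have := minc k; rewrite e eqxx ak /=; lia.
set y1 := raise j y b in Ey1.
have [sy1 Hy1] := estep_hgt n_gt1 Ey1; rewrite sy in sy1 Hy1.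
have Ey2 : estep j y1 c (raise j y1 c).
  apply: estep_intro; rewrite ?sy1 ?sy; try lia.
    move=> k kc; rewrite !Hy1 ?Hy ?c2' ?cij; try lia.
    have := minc' k; have := h3 k; do ?case: ifP; lia.
  move=> k kw; rewrite !Hy1 ?Hy ?c2' ?cij; try lia.
  by have := minc' k; have := h3 k; have := h4 k; do ?case: ifP; lia.
set y2 := raise j y1 c in Ey2.
have [sy2 Hy2] := estep_hgt n_gt1 Ey2; rewrite sy1 in sy2 Hy2.
have Et : estep i y2 d (raise i y2 d).
  apply: estep_intro; rewrite ?sy2 ?sy1 ?sy; try lia.
    move=> k kc; rewrite !Hy2 ?Hy1 ?Hy ?c2 ?cji; try lia.
    by have := mind' k; have := h1 k; have := h2 k; do ?case: ifP; lia.
  move=> k kw; rewrite !Hy2 ?Hy1 ?Hy ?c2 ?cji; try lia.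
  by have := mind' k; have := h1 k; have := h2 k; do ?case: ifP; lia.
have Ez1 : estep i z d (raise i z d).
  apply: estep_intro; rewrite ?sz; try lia.
    move=> k kc; rewrite !Hz ?cji; try lia.
    by have := mind' k; have := h1 k; have := h2 k; do ?case: ifP; lia.
  move=> k kw; rewrite !Hz ?cji; try lia.
  by have := mind' k; have := h1 k; have := h2 k; do ?case: ifP; lia.
set z1 := raise i z d in Ez1.
have [sz1 Hz1] := estep_hgt n_gt1 Ez1; rewrite sz in sz1 Hz1.
have Ez2 : estep i z1 a (raise i z1 a).
  apply: estep_intro; rewrite ?sz1; try lia.
    move=> k kc; rewrite !Hz1 ?Hz ?c2 ?cji; try lia.
    by have := mind' k; have := h1 k; have := h2 k; do ?case: ifP; lia.
  move=> k kw; rewrite !Hz1 ?Hz ?c2 ?cji; try lia.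
  by have := mind' k; have := h1 k; have := h2 k; do ?case: ifP; lia.
set z2 := raise i z1 a in Ez2.
have [sz2 Hz2] := estep_hgt n_gt1 Ez2; rewrite sz1 in sz2 Hz2.
have Et' : estep j z2 c (raise j z2 c).
  apply: estep_intro; rewrite ?sz2; try lia.
    move=> k kc; rewrite !Hz2 ?Hz1 ?Hz ?c2' ?cij; try lia.
    by have := minc' k; have := h3 k; have := h4 k; do ?case: ifP; lia.
  move=> k kw; rewrite !Hz2 ?Hz1 ?Hz ?c2' ?cij; try lia.
  by have := minc' k; have := h3 k; have := h4 k; do ?case: ifP; lia.
split; first by rewrite (estep_dep n_gt1 Ez1) Hz ?cji; try lia; do ?case: ifP; lia.
exists y1, y2, z1, z2, (raise i y2 d); split; last split.
- by split; [exists b|exists c|exists d].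
- split; [by exists d|by exists a|exists c].
  rewrite (_ : raise i y2 d = raise j z2 c) //.
  by rewrite /y2 /z2 /y1 /z1 ey ez; apply: raise_interleave; lia.
split.
  rewrite (estep_dep n_gt1 Et) !Hy2 ?Hy1 ?Hy ?c2 ?cji; try lia.
  by do ?case: ifP; lia.
rewrite (estep_dep n_gt1 Et') !Hz2 ?Hz1 ?Hz ?c2' ?cij; try lia.
by do ?case: ifP; lia.
Qed.

End Stembridge.

(** * Both halves of the local axioms, exchanged by duality *)

Section Duality.
Variable n : nat.
Hypothesis n_gt1 : (1 < n)%N.
Notation lword := (seq (letter n)).
Implicit Types (w x y z t : lword) (i j k a b c d : nat).
Notation nthl := (nth (l0 n)).
Notation th := (theta n).

(** The clauses on [dep] distinguish the square from the degree four relation. After dualising they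
    become conditions on [phi] by which one of the two alternatives can be excluded. *)
Lemma es_cases i j x y z : es i x y -> es j x z -> i != j ->
  ((exists t, es j y t /\ es i z t) /\ (dep j y = dep j x \/ dep i z = dep i x) /\
     (cart n i j = 0 \/ dep j y = dep j x + 1 \/ dep i z = dep i x + 1)) \/
  ([/\ cart n i j = -1, dep j y = dep j x + 1 & dep i z = dep i x + 1] /\
   exists y1 y2 z1 z2 t,
     [/\ es j y y1, es j y1 y2 & es i y2 t] /\
     [/\ es i z z1, es i z1 z2 & es j z2 t] /\
     dep i y2 = dep i x /\ dep j z2 = dep j x).
Proof.
move=> Ey Ez ij; have hi := es_lt n_gt1 Ey; have hj := es_lt n_gt1 Ez.
case: (cart_off n_gt1 hi hj ij) => [[cij cji]|[cij cji]].
  left; split; first exact: (es_square0 n_gt1 Ey Ez ij cij).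
  by have := es_dep_other n_gt1 Ey hj ij; split; [left; lia|left].
case: Ey Ez => [a Ea] [b Eb]; case: (ltngtP a b) => ab.
- have [e1 [[e2 sq]|[e2 [y1 [y2 [z1 [z2 [t [h1 [h2 [h3 h4]]]]]]]]]]] :=
    es_adjacent n_gt1 Ea Eb cij cji ab.
    by left; split=> //; split; [right|right; left].
  by right; split=> //; exists y1, y2, z1, z2, t.
- have [e1 [[e2 [t [h1 h2]]]|[e2 [y1 [y2 [z1 [z2 [t [h1 [h2 [h3 h4]]]]]]]]]]] :=
    es_adjacent n_gt1 Eb Ea cji cij ab.
    by left; split; [exists t|split; [left|right; right]].
  by right; split=> //; exists z1, z2, y1, y2, t.
(* Adjacent nodes never act on the same letter: raised at [i], it would pair with the [j]-th coroot
   to -2, which is impossible for a minuscule weight. *)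
subst b; have [_ si _] := estep_sg n_gt1 Ea; have [_ sj _] := estep_sg n_gt1 Eb.
have := sg_bound n_gt1 j (flip true i (nthl x a)).
by rewrite (sg_raise n_gt1) // sj cij.
Qed.

Definition eta w : lword := rev (map (@dual n) w).

Lemma eta_cat x y : eta (x ++ y) = eta y ++ eta x.
Proof. by rewrite /eta map_cat rev_cat. Qed.

Lemma etaK w : eta (eta w) = w.
Proof.
rewrite /eta map_rev revK -map_comp -[RHS]map_id; apply: eq_map => l /=.
exact: dualK.
Qed.

Lemma size_eta w : size (eta w) = size w.
Proof. by rewrite size_rev size_map. Qed.

Lemma tot_eta i w : tot (th i) (eta w) = - tot i w.
Proof.
rewrite /tot /eta (perm_big _ (permEl (perm_rev _))) big_map -sumrN.
by apply: eq_bigr => l _; rewrite sg_dual.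
Qed.

Lemma tot_cat i x y : tot i (x ++ y) = tot i x + tot i y.
Proof. by rewrite /tot big_cat. Qed.

Lemma hgt_eta i w k : (k <= size w)%N ->
  hgt (th i) (eta w) k = hgt i w (size w - k) - tot i w.
Proof.
move=> kw; rewrite -[in RHS](cat_take_drop (size w - k) w) tot_cat.
rewrite {2}/hgt cat_take_drop -/(tot i _).
rewrite -[LHS]/(tot (th i) (take k (eta w))) /eta take_rev size_map -map_drop.
rewrite -/(eta _) tot_eta; lia.
Qed.

Lemma dual_lower i (l : letter n) : (i < n)%N -> sg i l = 1 ->
  dual (flip false i l) = flip true (th i) (dual l).
Proof.
move=> hi sl; rewrite -{1}(dualK l) -{1}(thetaK n_gt1 i) -(dual_flip n_gt1) ?dualK ?theta_lt //.
by rewrite (sg_dual n_gt1) sl.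
Qed.

(** Reversing the word reads the path backwards from its endpoint, so the last minimum becomes the
    first and a lowering becomes a raising at the mirrored position. *)
Lemma es_eta i w w' : es i w w' -> es (th i) (eta w') (eta w).
Proof.
case=> a /(estep_fstep n_gt1) E; have [hi si _] := fstep_sg n_gt1 E.
case: E => aw h1 h2 e.
exists (size w' - a.+1)%N; split; rewrite ?size_eta; first lia.
- move=> k ka; rewrite !hgt_eta; try lia.
  have -> : (size w' - (size w' - a.+1).+1)%N = a by lia.
  by have := h1 (size w' - k)%N; lia.
- move=> k kw; rewrite !hgt_eta; try lia.
  have -> : (size w' - (size w' - a.+1).+1)%N = a by lia.
  by have := h2 (size w' - k)%N; lia.
have sw : size w = size w' by rewrite e size_upd.
apply: (@eq_from_nth _ (l0 n)); first by rewrite size_upd ?size_eta //; lia.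
move=> k; rewrite size_eta sw => kw; rewrite nth_upd /eta !nth_rev ?size_map //; try lia.
rewrite !(nth_map (l0 n)) ?sw; try lia.
have -> : (size w' - (size w' - a.+1).+1)%N = a by lia.
rewrite e nth_upd -(dual_lower hi si).
have -> : (size w' - k.+1 == a)%N = (k == size w' - a.+1)%N by lia.
by case: ifP.
Qed.

Lemma dep_eta i w : dep (th i) (eta w) = phi i w.
Proof.
have [h1 [k kw e]] := phi_hgt n_gt1 i w; apply: (depP n_gt1).
  move=> k'; rewrite size_eta => kw'; rewrite hgt_eta //.
  by have := h1 (size w - k')%N; lia.
exists (size w - k)%N; rewrite ?size_eta ?leq_subr //.
by rewrite hgt_eta ?leq_subr // subKn //; lia.
Qed.

Lemma es_etaV i x y : es (th i) (eta y) (eta x) -> es i x y.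
Proof. by move/es_eta; rewrite !etaK thetaK. Qed.

(** The information on [dep] at the bottom is turned into information on [phi] near the top [t],
    because the comparison of two components closes the diamond from [t] downwards. *)
Lemma es_diamond i j x y z : es i x y -> es j x z -> i != j ->
  (exists t, [/\ es j y t, es i z t & phi j z = phi j t \/ phi i y = phi i t]) \/
  (exists y1 y2 z1 z2 t,
     [/\ es j y y1, es j y1 y2 & es i y2 t] /\
     [/\ es i z z1, es i z1 z2 & es j z2 t] /\
     [/\ cart n i j = -1, phi j y2 = phi j t + 1 & phi i z2 = phi i t + 1]).
Proof.
move=> Ey Ez ij; have hi := es_lt n_gt1 Ey; have hj := es_lt n_gt1 Ez.
have ji : j != i by rewrite eq_sym.
have dy := es_dep n_gt1 Ey; have dz := es_dep n_gt1 Ez.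
have ty := fun k => es_tot n_gt1 k Ey; have tz := fun k => es_tot n_gt1 k Ez.
have cs := cart_off n_gt1 hi hj ij.
have oy := es_dep_other n_gt1 Ey hj ij; have oz := es_dep_other n_gt1 Ez hi ji.
have ci := cart2 n_gt1 hi; have cj := cart2 n_gt1 hj.
case: (es_cases Ey Ez ij) => [[[t [Et Et']] [c c']]|[[c0 c1 c2] [y1 [y2 [z1 [z2 [t]]]]]]].
  left; exists t; split=> //; rewrite /phi.
  have := es_dep n_gt1 Et; have := es_dep n_gt1 Et'.
  have := es_tot n_gt1 i Et; have := es_tot n_gt1 j Et'.
  have := es_tot n_gt1 i Et'; have := es_tot n_gt1 j Et.
  by move: (ty i) (ty j) (tz i) (tz j); lia.
move=> [[h1 h2 h3] [[h4 h5 h6] [h7 h8]]].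
right; exists y1, y2, z1, z2, t; do 2 (split; first by split).
split=> //; rewrite /phi.
  have := es_dep n_gt1 h1; have := es_dep n_gt1 h2; have := es_dep n_gt1 h6.
  by rewrite (es_tot n_gt1 j h3); lia.
have := es_dep n_gt1 h4; have := es_dep n_gt1 h5; have := es_dep n_gt1 h3.
by rewrite (es_tot n_gt1 i h6); lia.
Qed.

Lemma theta_neq i j : i != j -> th i != th j.
Proof. by apply: contraNneq => e; rewrite -(thetaK n_gt1 i) e thetaK. Qed.

(** The dual axioms come from the raising half through [eta], which exchanges [dep] and [phi]. *)
Lemma fs_square i j y z t : es i z t -> es j y t -> i != j ->
  phi j z = phi j t \/ phi i y = phi i t -> exists x, es j x z /\ es i x y.
Proof.
move=> Ez Ey ij c.
have [[[x []]]|[[_ c1 c2] _]] := es_cases (es_eta Ez) (es_eta Ey) (theta_neq ij).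
  rewrite -(etaK x) => /es_etaV h1 /es_etaV h2 _; exists (eta x); by [].
by move: c1 c2; rewrite !dep_eta; lia.
Qed.

Lemma fs_degree4 i j y2 z2 t : es i y2 t -> es j z2 t -> i != j ->
  phi j y2 = phi j t + 1 -> phi i z2 = phi i t + 1 ->
  exists y1 y z1 z x, [/\ es j y1 y2, es j y y1 & es i x y] /\
    [/\ es i z1 z2, es i z z1 & es j x z].
Proof.
move=> Ey Ez ij c1 c2.
have [[_ []]|[_ [y1 [y [z1 [z [x []]]]]]]] := es_cases (es_eta Ey) (es_eta Ez) (theta_neq ij).
  by rewrite !dep_eta; lia.
rewrite -(etaK y1) -(etaK y) -(etaK z1) -(etaK z) -(etaK x).
move=> [/es_etaV h1 /es_etaV h2 /es_etaV h3] [[/es_etaV h4 /es_etaV h5 /es_etaV h6] _].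
by exists (eta y1), (eta y), (eta z1), (eta z), (eta x).
Qed.

End Duality.

(** * Components with equal highest weight are isomorphic *)

Section Components.
Variable n : nat.
Hypothesis n_gt1 : (1 < n)%N.
Notation lword := (seq (letter n)).
Implicit Types (h w x y z t : lword) (i j k a b c d : nat) (ws : seq nat).
Notation th := (theta n).

Fixpoint down ws h x : Prop :=
  if ws is i :: ws' then exists2 y, down ws' h y & es i x y else x = h.

Definition hw h := forall i, dep i h = 0.

(** Elements reached by the same lowerings from two highest words. Whether the partner depends on
    the chosen sequence is left open here; the length [k] is what the induction runs on. *)
Definition paired k h h' x x' := exists2 ws, size ws = k & down ws h x /\ down ws h' x'.

Lemma paired_sym k h h' x x' : paired k h h' x x' -> paired k h' h x' x.
Proof. by case=> ws e [d d']; exists ws. Qed.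

Lemma paired_down k h h' x x' i y y' :
  paired k h h' y y' -> es i x y -> es i x' y' -> paired k.+1 h h' x x'.
Proof.
move=> [ws e [d d']] E E'; exists (i :: ws); rewrite /= ?e //.
by split; [exists y|exists y'].
Qed.

Lemma paired_tot k h h' x x' : (forall i, tot i h = tot i h') ->
  paired k h h' x x' -> forall i, tot i x = tot i x'.
Proof.
move=> e [ws _]; elim: ws x x' => [|j ws IH] x x' /=; first by case=> -> ->.
move=> [[y d E] [y' d' E']] i.
by have := IH _ _ (conj d d') i; rewrite (es_tot n_gt1 i E) (es_tot n_gt1 i E'); lia.
Qed.

(** Only one direction is recorded; the converse comes from the symmetry of [paired], since the
    statement quantifies over both highest words. *)
Definition lifts k := forall h h' x x' i y, hw h -> hw h' ->
  (forall i, tot i h = tot i h') -> paired k h h' x x' -> es i x y ->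
  exists k' y', [/\ k = k'.+1, es i x' y' & paired k' h h' y y'].

Lemma paired_dep k h h' x x' : (forall k', (k' <= k)%N -> lifts k') ->
  hw h -> hw h' -> (forall i, tot i h = tot i h') ->
  paired k h h' x x' -> forall i, dep i x = dep i x'.
Proof.
elim/ltn_ind: k x x' => k IH x x' L hh hh' te R i.
have [d0|d0] := ltP 0 (dep i x).
  have [y E] := es_ex n_gt1 d0.
  have [k' [y' [ek E' R']]] := L k (leqnn k) _ _ _ _ _ _ hh hh' te R E.
  have k'k : (k' < k)%N by lia.
  have L' : forall m, (m <= k')%N -> lifts m by move=> m mk; apply: L; lia.
  have := IH k' k'k y y' L' hh hh' te R' i.
  by rewrite (es_dep n_gt1 E) (es_dep n_gt1 E'); lia.
have [d1|d1] := ltP 0 (dep i x'); last by have := dep_ge0 n_gt1 i x; have := dep_ge0 n_gt1 i x'; lia.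
have [y E] := es_ex n_gt1 d1.
have te' i' : tot i' h' = tot i' h by rewrite te.
have [k' [y' [_ E' _]]] := L k (leqnn k) _ _ _ _ _ _ hh' hh te' (paired_sym R) E.
by have := es_dep_gt0 n_gt1 E'; lia.
Qed.

Lemma paired_fs k h h' x x' i y : (forall k', (k' <= k)%N -> lifts k') ->
  hw h -> hw h' -> (forall i, tot i h = tot i h') ->
  paired k h h' x x' -> es i y x -> exists2 y', es i y' x' & paired k.+1 h h' y y'.
Proof.
move=> L hh hh' te R E.
have : 0 < phi i x' by rewrite /phi -(paired_dep L hh hh' te R) -(paired_tot te R); apply: (es_phi_gt0 n_gt1 E).
by case/(fs_ex n_gt1) => y' E'; exists y' => //; apply: paired_down R E E'.
Qed.

(* The diamond above [x] is transported to the diamond above [x'], which is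
   then closed from its top [t'] downwards: the [phi]-conditions at [t] only
   involve elements above [x], where the pairing is already known to preserve
   [phi]. *)
Lemma lifts_all k : lifts k.
Proof.
elim/ltn_ind: k => k IH h h' x x' j z hh hh' te R Ez.
case: R => [[|i ws]] /= sk.
  case=> ex _; have := es_dep_gt0 n_gt1 Ez; rewrite ex hh; lia.
case: k IH sk => // k IH /succn_inj sk [[y dy Ey] [y' dy' Ey']].
have {ws sk dy dy'} R : paired k h h' y y' by exists ws.
have L m : (m <= k)%N -> forall m', (m' <= m)%N -> lifts m'.
  by move=> mk m' mm; apply: IH; lia.
have D m u u' : (m <= k)%N -> paired m h h' u u' -> forall i, phi i u = phi i u'.
  move=> mk Ru a; rewrite /phi (paired_dep (L m mk) hh hh' te Ru).
  by rewrite (paired_tot te Ru).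
have U m u u' a v : (m <= k)%N -> paired m h h' u u' -> es a u v ->
    exists m' v', [/\ m = m'.+1, es a u' v' & paired m' h h' v v'].
  by move=> mk; apply: IH.
have F m u u' a v : (m <= k)%N -> paired m h h' u u' -> es a v u ->
    exists2 v', es a v' u' & paired m.+1 h h' v v'.
  by move=> mk; apply: paired_fs (L m mk) hh hh' te.
have [ij|ij] := eqVneq i j.
  by subst j; rewrite -(es_det n_gt1 Ey Ez); exists k, y'.
have [[t [E1 E2 c]]|] := es_diamond n_gt1 Ey Ez ij.
  have [m [t' [em E1' Rt]]] := U _ _ _ _ _ (leqnn k) R E1; subst k.
  have [z' E2' Rz] := F _ _ _ _ _ (leqnSn m) Rt E2.
  have ny := D _ _ _ (leqnn _) R; have nz := D _ _ _ (leqnn _) Rz.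
  have nt := D _ _ _ (leqnSn _) Rt.
  rewrite ny nz !nt in c.
  have [x2 [E3 E4]] := fs_square n_gt1 E2' E1' ij c.
  by rewrite -(es_inj n_gt1 Ey' E4) in E3; exists m.+1, z'.
move=> [y1 [y2 [z1 [z2 [t [[E1 E2 E3] [[E4 E5 E6] [c0 c1 c2]]]]]]]].
have [m1 [y1' [em1 E1' R1]]] := U _ _ _ _ _ (leqnn k) R E1; subst k.
have [m2 [y2' [em2 E2' R2]]] := U _ _ _ _ _ (leqnSn _) R1 E2; subst m1.
have [m [t' [em E3' Rt]]] := U _ _ _ _ _ (ltnW (leqnSn _)) R2 E3; subst m2.
have [z2' E6' R6] := F _ _ _ _ _ (ltnW (ltnW (leqnSn _))) Rt E6.
have [z1' E5' R5] := F _ _ _ _ _ (ltnW (leqnSn _)) R6 E5.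
have [z' E4' R4] := F _ _ _ _ _ (leqnSn _) R5 E4.
have n1 := D _ _ _ (ltnW (leqnSn _)) R2; have n2 := D _ _ _ (ltnW (leqnSn _)) R6.
have nt := D _ _ _ (ltnW (ltnW (leqnSn _))) Rt.
rewrite n1 nt in c1; rewrite n2 nt in c2.
have [u1 [u [v1 [v [x2 [[G1 G2 G3] [G4 G5 G6]]]]]]] := fs_degree4 n_gt1 E3' E6' ij c1 c2.
rewrite -(es_inj n_gt1 E2' G1) in G2; rewrite -(es_inj n_gt1 E1' G2) in G3.
rewrite -(es_inj n_gt1 E5' G4) in G5; rewrite -(es_inj n_gt1 E4' G5) in G6.
by rewrite -(es_inj n_gt1 Ey' G3) in G6; exists m.+3, z'.
Qed.

(** * The correspondence between two components of equal highest weight *)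

Section Pairing.
Variables (h h' : lword).
Hypotheses (hh : hw h) (hh' : hw h') (te : forall i, tot i h = tot i h').

Definition iso x x' := exists ws, down ws h x /\ down ws h' x'.

Lemma iso_paired x x' : iso x x' <-> exists k, paired k h h' x x'.
Proof.
split=> [[ws d]|[k [ws _ d]]]; last by exists ws.
by exists (size ws), ws.
Qed.

Lemma iso_es i x x' y : iso x x' -> es i x y -> exists2 y', es i x' y' & iso y y'.
Proof.
move=> /iso_paired[k R] E.
have [k' [y' [_ E' R']]] := lifts_all hh hh' te R E.
by exists y' => //; apply/iso_paired; exists k'.
Qed.

Lemma iso_fs i x x' y : iso x x' -> es i y x -> exists2 y', es i y' x' & iso y y'.
Proof.
move=> /iso_paired[k R] E.
have [y' E' R'] := paired_fs (fun k' _ => @lifts_all k') hh hh' te R E.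
by exists y' => //; apply/iso_paired; exists k.+1.
Qed.

Lemma down_iso ws x : down ws h x -> exists x', down ws h' x' /\ iso x x'.
Proof.
elim: ws x => [|i ws IH] x /=; first by move=> ->; exists h'; split=> //; exists [::].
case=> y /IH[y' [d' R]] E; have [x' E' R'] := iso_fs R E.
by exists x'; split=> //; exists y'.
Qed.
End Pairing.

End Components.

(** * Highest elements and weights of components *)

Section Tops.
Variable n : nat.
Hypothesis n_gt1 : (1 < n)%N.
Notation lword := (seq (letter n)).
Implicit Types (h w x y z t : lword) (i j k a b c d : nat) (ws : seq nat).
Notation th := (theta n).

Definition pl w j : int := \sum_(l <- w) bitz l j.

Lemma sum_upd (f : letter n -> int) w a l : (a < size w)%N ->
  \sum_(l' <- upd w a l) f l' = \sum_(l' <- w) f l' + f l - f (nth (l0 n) w a).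
Proof.
move=> aw; rewrite /upd set_nthE aw.
have e : w = take a w ++ nth (l0 n) w a :: drop a.+1 w by rewrite -drop_nth ?cat_take_drop.
by rewrite [in RHS]e !big_cat !big_cons -e /=; lia.
Qed.

Lemma es_pl i w w' : es i w w' -> forall j, (j < n)%N -> pl w' j = pl w j + sroot n i j.
Proof.
case=> a E j jn; have [hi si _] := estep_sg n_gt1 E; case: E => aw _ _ ->.
rewrite /pl (sum_upd (fun l => bitz l j)) // (@bitz_flip _ n_gt1 true) ?expr1 //.
by rewrite sqrrN expr1n; lia.
Qed.

Lemma pl_bound w j : 0 <= pl w j <= (size w)%:Z.
Proof.
rewrite /pl; elim: w => [|l w IH]; first by rewrite big_nil.
move: IH; rewrite big_cons; move: (bitz01 l j) (\sum_(_ <- w) _) => h1 s h2.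
by rewrite [size _]/=; lia.
Qed.

(** The pairing of a coroot with the weight of coordinates [p j - m / 2]. It is stated for vectors
    so that reflections compose without naming the words that carry the weights. *)
Definition pair_vec (m : int) (p : nat -> int) i : int :=
  if (i.+1 < n)%N then p i - p i.+1
  else if i.+1 == n then p (n - 2)%N + p (n - 1)%N - m else 0.

Lemma tot_pl i w : tot i w = pair_vec (size w)%:Z (pl w) i.
Proof.
rewrite /tot /pair_vec /pl /sg; case: ifP => _; first by rewrite big_split sumrN.
case: ifP => _; last by rewrite big1.
elim: w => [|l w IH]; first by rewrite !big_nil.
by rewrite !big_cons IH /=; lia.
Qed.

(* The weights [n - 1 - j] make every simple root have height one. *)
Definition ht w : int := \sum_(j < n) (n - 1 - j)%N%:Z * pl w j.

Lemma sum_delta (f : nat -> int) a : (a < n)%N ->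
  \sum_(j < n) f j * (j == a :> nat)%:Z = f a.
Proof.
move=> an; rewrite (bigD1 (Ordinal an)) //= eqxx mulr1 big1 ?addr0 // => j ja.
by rewrite (_ : (j == a :> nat) = false) ?mulr0 //; apply: negbTE.
Qed.

Lemma es_ht i w w' : es i w w' -> ht w' = ht w + 1.
Proof.
move=> E; have hi := es_lt n_gt1 E; rewrite /ht.
under eq_bigr do rewrite (es_pl E) // mulrDr.
rewrite big_split /=; congr (_ + _); rewrite /sroot.
case: (ltnP i.+1 n) => h1.
  under eq_bigr do rewrite mulrBr.
  by rewrite sumrB !(sum_delta (fun j => (n - 1 - j)%N%:Z)); lia.
have -> : i.+1 == n by lia.
under eq_bigr do rewrite mulrDr.
by rewrite big_split /= !(sum_delta (fun j => (n - 1 - j)%N%:Z)); lia.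
Qed.

Definition ht_max (m : nat) : int := \sum_(j < n) (n - 1 - j)%N%:Z * m%:Z.

Lemma ht_bound w : ht w <= ht_max (size w).
Proof. by apply: ler_sum => j _; have := pl_bound w j; nia. Qed.

Lemma hwP x : hw x \/ exists i y, es i x y.
Proof.
case: (excluded_middle_informative (exists i y, es i x y)) => h; [by right|left].
move=> i; have := dep_ge0 n_gt1 i x; case: (ltP 0 (dep i x)) => // d; last by lia.
by case: h; exists i; apply: es_ex.
Qed.

Lemma hw_es h i y : hw h -> ~ es i h y.
Proof. by move=> hh E; have := es_dep_gt0 n_gt1 E; rewrite hh. Qed.

(** Induction towards the highest element, well-founded because [ht] grows by one at each raising
    and is bounded on words of a given length. *)
Lemma up_ind (P : lword -> Prop) :
  (forall x, (forall i y, es i x y -> P y) -> P x) -> forall x, P x.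
Proof.
move=> H x; have [k] := ubnP `|ht_max (size x) - ht x|%N.
elim: k x => // k IH x hk; apply: H => i y E; apply: IH.
by have := ht_bound y; have := es_ht E; rewrite (es_size n_gt1 E); lia.
Qed.

Lemma ex_top x : exists h, hw h /\ exists ws, down ws h x.
Proof.
elim/up_ind: x => x IH; case: (hwP x) => [hx|[i [y E]]].
  by exists x; split=> //; exists [::].
have [h [hh [ws d]]] := IH i y E; exists h; split=> //.
by exists (i :: ws); exists y.
Qed.

(** Newman's argument: [up_ind] provides termination and [es_diamond] local confluence. *)
Lemma top_unique x : forall h h' ws ws', hw h -> hw h' ->
  down ws h x -> down ws' h' x -> h = h'.
Proof.
elim/up_ind: x => x IH h h' [|i ws] [|j ws'] hh hh' /=; first by move=> <- <-.
- by move=> e [y _ E]; case: (@hw_es h j y hh); rewrite -e.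
- by move=> [y _ E] e; case: (@hw_es h' i y hh'); rewrite -e.
move=> [y dy Ey] [z dz Ez].
suff [h3 [hh3 [w1 d1] [w2 d2]]] :
    exists h3, [/\ hw h3, exists ws1, down ws1 h3 y & exists ws2, down ws2 h3 z].
  by rewrite (IH _ _ Ey _ _ _ _ hh hh3 dy d1) (IH _ _ Ez _ _ _ _ hh' hh3 dz d2).
have [ij|ij] := eqVneq i j.
  by subst j; have e := es_det n_gt1 Ey Ez; subst z; exists h; split=> //; exists ws.
have [[t [E1 E2 _]]|] := es_diamond n_gt1 Ey Ez ij.
  have [h3 [hh3 [ws3 d3]]] := ex_top t; exists h3; split=> //.
    by exists (j :: ws3); exists t.
  by exists (i :: ws3); exists t.
move=> [y1 [y2 [z1 [z2 [t [[E1 E2 E3] [[E4 E5 E6] _]]]]]]].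
have [h3 [hh3 [ws3 d3]]] := ex_top t; exists h3; split=> //.
  exists [:: j, j, i & ws3]; exists y1 => //; exists y2 => //; by exists t.
exists [:: i, i, j & ws3]; exists z1 => //; exists z2 => //; by exists t.
Qed.

Definition top x : lword := epsilon (inhabits x) (fun h => hw h /\ exists ws, down ws h x).

Lemma topP x : hw (top x) /\ exists ws, down ws (top x) x.
Proof. exact: (epsilon_spec (inhabits x) _ (ex_top x)). Qed.

Lemma top_hw x : hw (top x).
Proof. by case: (topP x). Qed.

Lemma top_down x : exists ws, down ws (top x) x.
Proof. by case: (topP x). Qed.

Lemma topE ws h x : hw h -> down ws h x -> top x = h.
Proof. by move=> hh d; have [ws' d'] := top_down x; apply: top_unique d' d => //; apply: top_hw. Qed.

Lemma top_id h : hw h -> top h = h.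
Proof. by move=> hh; apply: (@topE [::]). Qed.

Lemma top_es i x y : es i x y -> top x = top y.
Proof.
move=> E; have [ws d] := top_down y; apply: (@topE (i :: ws)); first exact: top_hw.
by exists y.
Qed.

Lemma down_size ws h x : down ws h x -> size x = size h.
Proof.
elim: ws x => [|i ws IH] x /=; first by move=> ->.
by case=> y /IH <- /(es_size n_gt1).
Qed.

Lemma size_top x : size (top x) = size x.
Proof. by have [ws /down_size] := top_down x. Qed.

Lemma down_ht ws h x : down ws h x -> ht h = ht x + (size ws)%:Z.
Proof.
elim: ws x => [|i ws IH] x /=; first by move=> ->; rewrite addr0.
by case=> y /IH -> /es_ht; lia.
Qed.

Lemma ht_top x : ht x <= ht (top x).
Proof. by have [ws /down_ht] := top_down x; lia. Qed.

Lemma ht_top_eq x : ht x = ht (top x) -> x = top x.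
Proof. by have [[|i ws]] := top_down x; first by []; move=> /down_ht /=; lia. Qed.

Lemma es_string i x k : (k%:Z <= dep i x) ->
  exists y, [/\ top y = top x, size y = size x &
    forall j, (j < n)%N -> pl y j = pl x j + k%:Z * sroot n i j].
Proof.
elim: k x => [|k IH] x kd; first by exists x; split=> // j _; rewrite mul0r addr0.
have [|x' E] := @es_ex _ n_gt1 i x; first by lia.
have [|y [e1 e2 e3]] := IH x'; first by rewrite (es_dep n_gt1 E); lia.
exists y; rewrite e1 e2 (top_es E) (es_size n_gt1 E); split=> // j jn.
by rewrite e3 // (es_pl E) //; lia.
Qed.

Lemma fs_string i x k : (k%:Z <= phi i x) ->
  exists y, [/\ top y = top x, size y = size x &
    forall j, (j < n)%N -> pl y j = pl x j - k%:Z * sroot n i j].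
Proof.
elim: k x => [|k IH] x kd; first by exists x; split=> // j _; rewrite mul0r subr0.
have [|x' E] := @fs_ex _ n_gt1 i x; first by lia.
have [|y [e1 e2 e3]] := IH x'; first by have := es_phi n_gt1 E; lia.
exists y; rewrite e1 e2 -(top_es E) (es_size n_gt1 E); split=> // j jn.
by rewrite e3 // (es_pl E) //; lia.
Qed.

(** * Weyl group symmetry of the weights in a component *)

Section Weyl.
Variable x0 : lword.
Let m : int := (size x0)%:Z.

Definition is_weight (p : nat -> int) :=
  exists y, [/\ top y = top x0, size y = size x0 & forall j, (j < n)%N -> pl y j = p j].

Lemma is_weight_ext p q : (forall j, (j < n)%N -> p j = q j) -> is_weight p -> is_weight q.
Proof. by move=> e [y [h1 h2 h3]]; exists y; split=> // j jn; rewrite h3 // e. Qed.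

(** As [phi - dep] is the pairing with the coroot, the string through a word reaches at least as far
    as the reflected weight, downwards or upwards according to the sign. *)
Lemma is_weight_refl i p : (i < n)%N -> is_weight p ->
  is_weight (fun j => p j - pair_vec m p i * sroot n i j).
Proof.
move=> hi [y [h1 h2 h3]].
have e : tot i y = pair_vec m p i.
  by rewrite tot_pl h2 /pair_vec -/m; do ?case: ifP => ?; rewrite ?h3; lia.
case: (leP 0 (tot i y)) => t0.
  have [|z [e1 e2 e3]] := @fs_string i y `|tot i y|%N.
    by rewrite /phi; have := dep_ge0 n_gt1 i y; lia.
  exists z; rewrite e1 e2; split=> // j jn; rewrite e3 // h3 // -e; lia.
have [|z [e1 e2 e3]] := @es_string i y `|tot i y|%N.
  by have := phi_ge0 n_gt1 i y; rewrite /phi; lia.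
exists z; rewrite e1 e2; split=> // j jn; rewrite e3 // h3 // -e; lia.
Qed.

Definition swap_at i (p : nat -> int) j :=
  if j == i then p i.+1 else if j == i.+1 then p i else p j.

(** Since [p j] is a weight coordinate plus [m / 2], the value [m - p j] is a change of sign. The
    Weyl group of type D contains sign changes in pairs only. *)
Definition negate_at i (p : nat -> int) j :=
  if (j == i) || (j == i.+1) then m - p j else p j.

Lemma is_weight_swap i p : (i.+1 < n)%N -> is_weight p -> is_weight (swap_at i p).
Proof.
move=> hi /(is_weight_refl (ltnW hi)); apply: is_weight_ext => j jn.
rewrite /swap_at /pair_vec /sroot hi; case: (eqVneq j i) => [->|ji].
  by rewrite (_ : (i == i.+1) = false); lia.
by case: (eqVneq j i.+1) => [->|]; lia.
Qed.

Lemma is_weight_negate i p : (i.+1 < n)%N -> is_weight p -> is_weight (negate_at i p).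
Proof.
move=> hi; have [k ek] : exists k, (k + i = n - 2)%N by exists (n - 2 - i)%N; lia.
elim: k i p hi ek => [|k IH] i p hi ek Q.
  have e2 : i.+2 = n by lia.
  have hn : (n - 1 < n)%N by lia.
  have := is_weight_swap hi (is_weight_refl hn Q); apply: is_weight_ext => j jn.
  have ei : (n - 2)%N = i by lia.
  have ei' : (n - 1)%N = i.+1 by lia.
  rewrite /swap_at /negate_at /pair_vec /sroot ei' ei e2 ltnn eqxx.
  have a1 : (i.+1 == i) = false by lia.
  have a2 : (i == i.+1) = false by lia.
  case: (eqVneq j i) => [->|ji] /=; first by rewrite a1 eqxx /=; lia.
  case: (eqVneq j i.+1) => [->|ji'] /=; first by rewrite eqxx a2 /=; lia.
  by lia.
have hi' : (i.+2 < n)%N by lia.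
(* Conjugation by two transpositions carries the coordinates [i, i.+1] to [i.+1, i.+2], where the
   induction hypothesis negates them. The base case is the last simple reflection, which negates and
   exchanges the last two coordinates. *)
have := is_weight_swap hi' (is_weight_swap hi (IH i.+1 _ hi' ltac:(lia)
  (is_weight_swap hi (is_weight_swap hi' Q)))).
apply: is_weight_ext => j jn; rewrite /swap_at /negate_at.
have a1 : (i.+1 == i) = false by lia.
have a2 : (i == i.+1) = false by lia.
have a3 : (i.+2 == i) = false by lia.
have a4 : (i == i.+2) = false by lia.
have a5 : (i.+2 == i.+1) = false by lia.
have a6 : (i.+1 == i.+2) = false by lia.
case: (eqVneq j i.+1) => [->|j1] /=; first by rewrite ?(eqxx, a1, a2, a3, a4, a5, a6) /=.
case: (eqVneq j i.+2) => [->|j2] /=; first by rewrite ?(eqxx, a1, a2, a3, a4, a5, a6) /=.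
case: (eqVneq j i) => [->|j3] /=; first by rewrite ?(eqxx, a1, a2, a3, a4, a5, a6) /=.
by rewrite ?(negPf j1, negPf j2, negPf j3).
Qed.

Lemma is_weight_negate_first k p : (k.*2 <= n)%N -> is_weight p ->
  is_weight (fun j => if (j < k.*2)%N then m - p j else p j).
Proof.
elim: k => [|k IH] hk Q; first exact: is_weight_ext Q.
have := is_weight_negate (i := k.*2) ltac:(lia) (IH ltac:(lia) Q).
apply: is_weight_ext => j jn; rewrite /negate_at doubleS.
by do ?case: ifP => //; lia.
Qed.
End Weyl.

(** * Equality of the highest weights of a word and its dual *)

Lemma pl_eta w j : (j < n)%N ->
  pl (eta w) j = if odd n && (j == n.-1) then pl w j else (size w)%:Z - pl w j.
Proof.
move=> jn; rewrite /pl /eta (perm_big _ (permEl (perm_rev _))) big_map /=.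
under eq_bigr do rewrite bitz_dual //.
case: ifP => // _; elim: w => [|l w IH]; first by rewrite !big_nil.
by rewrite !big_cons IH /=; lia.
Qed.

Lemma weight_eta x : exists y, [/\ top y = top x, size y = size x &
  forall j, (j < n)%N -> pl y j = pl (eta x) j].
Proof.
have Q : is_weight x (pl x) by exists x.
(* Negating [n./2] pairs gives w0: all coordinates for even [n], all but the last for odd [n], as in
   [dual]. *)
have [y [h1 h2 h3]] := is_weight_negate_first (k := n./2) ltac:(lia) Q.
exists y; split=> // j jn; rewrite h3 // pl_eta //.
by have := odd_double_half n; do ?case: ifP => //; lia.
Qed.

Lemma ht_pl x y : (forall j, (j < n)%N -> pl x j = pl y j) -> ht x = ht y.
Proof. by move=> e; apply: eq_bigr => j _; rewrite e. Qed.

Lemma top_eta_es i x y : es i x y -> top (eta x) = top (eta y).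
Proof. by move=> /(es_eta n_gt1) /top_es ->. Qed.

Lemma top_eta_down ws h x : down ws h x -> top (eta x) = top (eta h).
Proof.
elim: ws x => [|i ws IH] x /=; first by move=> ->.
by case=> y /IH <- /top_eta_es.
Qed.

Lemma top_eta x y : top x = top y -> top (eta x) = top (eta y).
Proof.
have [ws d] := top_down x; have [ws' d'] := top_down y => e.
by rewrite (top_eta_down d) (top_eta_down d') e.
Qed.

(* Each component contains, with [x], an element of weight [w0 (wt x)]; the
   highest elements of the components of [x] and [eta x] therefore bound each
   other in height. *)
Lemma ht_top_eta x : exists2 y, top y = top x &
  forall j, (j < n)%N -> pl y j = pl (top (eta x)) j.
Proof.
have [y [h1 h2 h3]] := weight_eta (eta (top (eta x))).
exists y; last by move=> j jn; rewrite h3 // etaK.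
rewrite h1 -[in RHS](etaK x); apply: top_eta.
by rewrite top_id //; apply: top_hw.
Qed.

Lemma pl_top_eta x j : (j < n)%N -> pl (top (eta x)) j = pl (top x) j.
Proof.
have [y ey py] := ht_top_eta x; have [z ez pz] := ht_top_eta (eta x).
(* The two tops bound each other in height, so [y] has the height of the top of its component and
   therefore is that top. *)
rewrite etaK in pz => jn; rewrite -py // -ey; congr (pl _ j).
apply: ht_top_eq; apply/eqP; rewrite eq_le ht_top /= ey.
by rewrite -(ht_pl pz) (ht_pl py) -ez ht_top.
Qed.

Lemma tot_pl_eq x y : size x = size y -> (forall j, (j < n)%N -> pl x j = pl y j) ->
  forall i, tot i x = tot i y.
Proof.
move=> es e i; rewrite !tot_pl es /pair_vec.
by do ?case: ifP => ?; rewrite ?e //; lia.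
Qed.

Lemma tot_top_eta x i : tot i (top (eta x)) = tot i (top x).
Proof.
apply: tot_pl_eq; first by rewrite !size_top size_eta.
exact: pl_top_eta.
Qed.

End Tops.

(** * The Schuetzenberger involution and the Bender-Knuth generators *)

Section Involution.
Variable n : nat.
Hypothesis n_gt1 : (1 < n)%N.
Notation lword := (seq (letter n)).
Implicit Types (h w x y z t u v : lword) (i j k a : nat) (b c l : letter n) (ws : seq nat).
Notation th := (theta n).

Lemma iso_fun h h' x x1 x2 : hw h -> hw h' -> (forall i, tot i h = tot i h') ->
  iso h h' x x1 -> iso h h' x x2 -> x1 = x2.
Proof.
move=> hh hh' te; elim/(up_ind n_gt1): x x1 x2 => x IH x1 x2 R1 R2.
case: (hwP n_gt1 x) => [hx|[i [y E]]].
  case: R1 R2 => [ws1 [d1 e1]] [ws2 [d2 e2]].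
  have ex : x = h by rewrite -(topE n_gt1 hh d1) top_id.
  move: (down_ht n_gt1 d1) (down_ht n_gt1 d2); rewrite ex.
  case: ws1 d1 e1 => [|? ws1] d1 e1; last by rewrite /=; lia.
  by case: ws2 d2 e2 => [|? ws2] d2 e2; [rewrite e1 e2|rewrite /=; lia].
have [y1 E1 S1] := iso_es n_gt1 hh hh' te R1 E.
have [y2 E2 S2] := iso_es n_gt1 hh hh' te R2 E.
by move: E1; rewrite (IH i y E _ _ S1 S2) => E1; apply: (es_inj n_gt1 E1 E2).
Qed.

(** [eta x] already obeys the exchange relations of the involution, but in its own component; the
    isomorphism of components carries it back to the component of [x]. *)
Definition xiw x : lword :=
  epsilon (inhabits x) (iso (top (eta x)) (top x) (eta x)).

Lemma xiwP x : iso (top (eta x)) (top x) (eta x) (xiw x).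
Proof.
apply: (epsilon_spec (inhabits x)).
have [ws d] := top_down n_gt1 (eta x).
have [x' [_ R]] := down_iso n_gt1 (top_hw n_gt1 _) (top_hw n_gt1 x) (tot_top_eta n_gt1 x) d.
by exists x'.
Qed.

Lemma xiw_es i x y : es i x y -> es (th i) (xiw y) (xiw x).
Proof.
move=> E; have R := xiwP y.
rewrite -(top_eta_es n_gt1 E) -(top_es n_gt1 E) in R.
have [x' E' R'] := iso_es n_gt1 (top_hw n_gt1 _) (top_hw n_gt1 x)
  (tot_top_eta n_gt1 x) R (es_eta n_gt1 E).
by rewrite (iso_fun (top_hw n_gt1 _) (top_hw n_gt1 x) (tot_top_eta n_gt1 x) (xiwP x) R').
Qed.

Lemma top_xiw x : top (xiw x) = top x.
Proof.
by have [ws [_ d]] := xiwP x; rewrite (topE n_gt1 (top_hw n_gt1 x) d).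
Qed.

Lemma size_xiw x : size (xiw x) = size x.
Proof. by rewrite -(size_top n_gt1 (xiw x)) top_xiw size_top. Qed.

Lemma iso_pl h h' y y' j : (j < n)%N -> pl h j = pl h' j -> iso h h' y y' ->
  pl y j = pl y' j.
Proof.
move=> jn e [ws []]; elim: ws y y' => [|i ws IH] y y' /=; first by move=> -> ->.
move=> [z d E] [z' d' E']; have := IH _ _ d d'.
by rewrite (es_pl n_gt1 E jn) (es_pl n_gt1 E' jn); lia.
Qed.

Lemma pl_xiw x j : (j < n)%N -> pl (xiw x) j = pl (eta x) j.
Proof. by move=> jn; rewrite (iso_pl jn (pl_top_eta n_gt1 x jn) (xiwP x)). Qed.

(** A highest element is the only element of its height in its component, hence fixed by [g];
    injectivity of the raising operators carries fixedness down to all other elements. *)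
Lemma crystal_endo_id (g : lword -> lword) :
  (forall i x y, es i x y -> es i (g x) (g y)) ->
  (forall x, top (g x) = top x) -> (forall x, ht (g x) = ht x) -> g =1 id.
Proof.
move=> ge gt gh; elim/(up_ind n_gt1) => x IH.
case: (hwP n_gt1 x) => [hx|[i [y E]]].
  rewrite (ht_top_eq n_gt1 (x := g x)); first by rewrite gt top_id.
  by rewrite gh gt top_id.
by have := ge _ _ _ E; rewrite (IH _ _ E) => E'; apply: (es_inj n_gt1 E' E).
Qed.

Lemma xiwK x : xiw (xiw x) = x.
Proof.
apply: (@crystal_endo_id (xiw \o xiw)) => [i y z E|y|y] /=.
- by have := xiw_es (xiw_es E); rewrite thetaK.
- by rewrite !top_xiw.
apply: ht_pl => j jn; rewrite !pl_xiw // pl_eta // size_xiw !pl_xiw // pl_eta //.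
by case: (odd n && _) => //; rewrite subKr.
Qed.

(** Four arrow reversals compose to an arrow-preserving map, to which rigidity applies. The
    resulting commutation makes [evac] an involution. *)
Lemma eta_xiw_eta x : eta (xiw (eta x)) = xiw x.
Proof.
suff e : xiw (eta (xiw (eta x))) = x by rewrite -[in RHS]e xiwK.
apply: (@crystal_endo_id (fun x => xiw (eta (xiw (eta x))))) => [i y z E|y|y].
- have := xiw_es (es_eta n_gt1 (xiw_es (es_eta n_gt1 E))).
  by rewrite !(thetaK n_gt1).
- rewrite top_xiw -[RHS](congr1 (@top n) (etaK y)); apply: top_eta => //.
  by rewrite top_xiw.
apply: ht_pl => j jn; rewrite pl_xiw // etaK pl_xiw // etaK.
by [].
Qed.

Definition evac x : lword := xiw (eta x).

Lemma size_evac x : size (evac x) = size x.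
Proof. by rewrite size_xiw size_eta. Qed.

Lemma evac_es i x y : es i x y -> es i (evac x) (evac y).
Proof. by move=> /(es_eta n_gt1) /xiw_es; rewrite thetaK. Qed.

Lemma evacK x : evac (evac x) = x.
Proof. by rewrite /evac eta_xiw_eta xiwK. Qed.

Lemma pl_evac x j : (j < n)%N -> pl (evac x) j = pl x j.
Proof. by move=> jn; rewrite pl_xiw // etaK. Qed.

Lemma tot_evac x i : tot i (evac x) = tot i x.
Proof. by apply: tot_pl_eq => //; [apply: size_evac|apply: pl_evac]. Qed.

Lemma hw_evac x : hw x -> hw (evac x).
Proof.
move=> hx; case: (hwP n_gt1 (evac x)) => // -[i [y /evac_es]].
by rewrite evacK => /(hw_es n_gt1 hx).
Qed.

Lemma eq_size1 x y : size x = 1%N -> size y = 1%N ->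
  (forall j, (j < n)%N -> pl x j = pl y j) -> x = y.
Proof.
case: x => [|l []] //; case: y => [|l' []] // _ _ e; congr [:: _].
apply: letterP => j jn; apply: bitz_inj.
by have := e j jn; rewrite /pl !big_seq1.
Qed.

Lemma xiw1 l : xiw [:: l] = eta [:: l].
Proof. by apply: eq_size1; rewrite ?size_xiw ?size_eta //; apply: pl_xiw. Qed.

Lemma evac1 x : size x = 1%N -> evac x = x.
Proof.
by move=> sx; apply: eq_size1; rewrite ?size_evac // => j jn; rewrite pl_evac.
Qed.

Lemma evac0 : evac [::] = [::].
Proof. by apply: size0nil; rewrite size_evac. Qed.

(** * Prefixes and suffixes of a word *)

Lemma hgt_cat i x y k : hgt i (x ++ y) k =
  if (k <= size x)%N then hgt i x k else tot i x + hgt i y (k - size x).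
Proof.
rewrite /hgt take_cat; case: (ltngtP k (size x)) => kx //.
  by rewrite big_cat.
by rewrite kx subnn take0 cats0 take_size.
Qed.

Lemma upd_cat x y a l : upd (x ++ y) a l =
  if (a < size x)%N then upd x a l ++ y else x ++ upd y (a - size x) l.
Proof.
elim: x a => [|l' x IH] [|a] //=.
by have := IH a; rewrite /upd /= ltnS subSS => ->; case: ifP.
Qed.

Lemma es_cat i x y x' y' : size x' = size x -> es i (x ++ y) (x' ++ y') ->
  (x' = x /\ es i y y') \/ (y' = y /\ es i x x').
Proof.
move=> sx [a E]; have [hi si ha] := estep_sg n_gt1 E; case: E => aw h1 h2.
rewrite size_cat in aw h2.
case: (ltnP a (size x)) => ax.
  rewrite upd_cat nth_cat ax => /eqP; rewrite eqseq_cat; last first.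
    by rewrite (size_upd _ ax).
  move=> /andP[/eqP ex /eqP ey]; right; split=> //; exists a; split=> //.
    move=> k ka; have := h1 k ka; rewrite !hgt_cat ax.
    by have -> : (k <= size x)%N by lia.
  move=> k kx; have := h2 k; rewrite !hgt_cat ax kx; apply; lia.
rewrite upd_cat nth_cat ltnNge ax /= => /eqP; rewrite eqseq_cat //.
move=> /andP[/eqP ex /eqP ey]; left; split=> //; exists (a - size x)%N.
have e : (a.+1 - size x = (a - size x).+1)%N by lia.
split=> //; first lia.
  move=> k ka; have := h1 (size x + k)%N; rewrite !hgt_cat ltnNge ax /= e.
  case: ifP => kx.
    have -> : k = 0%N by lia.
    rewrite addn0 hgt0 hgt_size; have := h1 (size x); rewrite !hgt_cat leqnn ltnNge ax /= e hgt_size; lia.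
  by rewrite addKn; lia.
move=> k ka; have := h2 (size x + k)%N; rewrite !hgt_cat ltnNge ax /= e.
case: ifP => kx.
  have -> : k = 0%N by lia.
  by rewrite addn0 hgt0 hgt_size; lia.
by rewrite addKn; lia.
Qed.

(** A raising changes a single letter and acts as a raising on the factor containing it. The
    components of a prefix and of a suffix are thus invariants of the component of the whole
    word. *)
Lemma top_take_es i w w' k : es i w w' ->
  top (take k w) = top (take k w') /\ top (drop k w) = top (drop k w').
Proof.
move=> E; have sz := es_size n_gt1 E.
have [||[-> E']|[-> E']] := @es_cat i (take k w) (drop k w) (take k w') (drop k w').
- by rewrite !size_take sz.
- by rewrite !cat_take_drop.
- by split=> //; apply: top_es E'.
by split=> //; apply: top_es E'.
Qed.

Lemma top_take_top w k : top (take k w) = top (take k (top w)) /\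
  top (drop k w) = top (drop k (top w)).
Proof.
have [ws] := top_down n_gt1 w; move: (top w) => h.
elim: ws w => [|i ws IH] w /=; first by move=> ->.
by case=> y /IH[<- <-] E; have [-> ->] := top_take_es k E.
Qed.

Lemma top_take w w' k : top w = top w' -> top (take k w) = top (take k w').
Proof. by move=> e; rewrite (top_take_top w k).1 (top_take_top w' k).1 e. Qed.

Lemma top_drop w w' k : top w = top w' -> top (drop k w) = top (drop k w').
Proof. by move=> e; rewrite (top_take_top w k).2 (top_take_top w' k).2 e. Qed.

Lemma hw_hgt w : hw w <-> (forall i k, (k <= size w)%N -> 0 <= hgt i w k).
Proof.
split=> [hh i k kw|hh i].
  by have [/(_ k kw)] := dep_hgt n_gt1 i w; rewrite hh; lia.
apply: (depP n_gt1) => [k kw|]; first by have := hh i k kw; lia.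
by exists 0%N; rewrite ?hgt0.
Qed.

Lemma hw_catl x y : hw (x ++ y) -> hw x.
Proof.
move=> /hw_hgt hh; apply/hw_hgt => i k kx.
by have := hh i k; rewrite hgt_cat kx size_cat; apply; lia.
Qed.

Lemma hw_cat_subst x x' y : hw x' -> size x' = size x ->
  (forall i, tot i x' = tot i x) -> hw (x ++ y) -> hw (x' ++ y).
Proof.
move=> /hw_hgt hx' sx te /hw_hgt hxy; apply/hw_hgt => i k; rewrite size_cat => kw.
rewrite hgt_cat; case: ifP => kx; first by apply: hx'.
have := hxy i k; rewrite hgt_cat size_cat -sx kx -te; apply; lia.
Qed.

Definition evac_at k w : lword := evac (take k w) ++ drop k w.

(* The composite [T_i]; since [evac_at 0] and [evac_at 1] are the identity, this
   one formula covers the three cases in the definition of [T]. *)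
Definition bk_op i w : lword := evac_at i (evac_at i.+1 (evac_at i (evac_at i.-1 w))).

(** Since [evac] is [xiw] after [eta], and [eta] exchanges the two ends of a word while [xiw]
    preserves components, it is enough to follow which component each prefix or suffix lies in.
    Highest words are then recovered from their components. *)
Lemma bk_op_hw u b c r : hw (u ++ [:: b; c]) ->
  exists b0 u' c', [/\ bk_op (size u).+1 (u ++ [:: b, c & r]) = top (u' ++ [:: c]) ++ c' :: r,
    size u' = size u /\ top u' = u,
    hw (b0 :: u') /\ hw (b0 :: u' ++ [:: c]),
    hw (top (u' ++ [:: c]) ++ [:: c']) &
    forall j, (j < n)%N -> pl (top (u' ++ [:: c]) ++ [:: c']) j = pl (u ++ [:: b; c]) j].
Proof.
have plc x y j : pl (x ++ y) j = pl x j + pl y j by rewrite /pl big_cat.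
move=> hubc; have hub : hw (u ++ [:: b]).
  by apply: (@hw_catl _ [:: c]); rewrite -catA.
have hu := hw_catl hub.
have hSub : hw (evac u ++ [:: b]).
  apply: hw_cat_subst hub; [exact: hw_evac|exact: size_evac|exact: tot_evac].
have step1 : evac_at (size u) (u ++ [:: b, c & r]) = evac u ++ [:: b, c & r].
  by rewrite /evac_at take_size_cat // drop_size_cat.
have step2 : evac_at (size u).+1 (evac u ++ [:: b, c & r]) =
    evac (evac u ++ [:: b]) ++ c :: r.
  rewrite -cat1s catA /evac_at take_size_cat ?drop_size_cat //;
  by rewrite size_cat size_evac addn1.
(* Here [eta] brings [b] to the front and leaves [xiw u] behind it. Dropping the first letter of the
   result therefore gives a word in the component of [u]. *)
have ev : evac (evac u ++ [:: b]) = xiw (eta [:: b] ++ xiw u).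
  by rewrite /evac eta_cat eta_xiw_eta.
have hv : hw (evac (evac u ++ [:: b])) by apply: hw_evac.
have sv : size (evac (evac u ++ [:: b])) = (size u).+1.
  by rewrite size_evac size_cat size_evac addn1.
have tv i : tot i (evac (evac u ++ [:: b])) = tot i (u ++ [:: b]).
  by rewrite tot_evac !tot_cat tot_evac.
have pv j : (j < n)%N -> pl (evac (evac u ++ [:: b])) j = pl (u ++ [:: b]) j.
  by move=> jn; rewrite pl_evac // !plc pl_evac.
have tdv : top (drop 1 (evac (evac u ++ [:: b]))) = u.
  rewrite ev (@top_drop _ (eta [:: b] ++ xiw u)) ?top_xiw // drop_size_cat //.
  by rewrite top_xiw top_id.
case: (evac (evac u ++ [:: b])) step2 ev hv sv tv pv tdv => [//|b0 u'] step2 ev hv [su'] tv pv.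
rewrite drop1 /= => tu'.
have hvc : hw ((b0 :: u') ++ [:: c]).
  apply: hw_cat_subst hv _ tv _; first by rewrite /= su' size_cat addn1.
  by rewrite -catA.
have hq := hw_evac hvc.
have sq : size (evac ((b0 :: u') ++ [:: c])) = (size u).+2.
  by rewrite size_evac size_cat /= su' addn1.
(* [eta] sends [b0] to the last place, so the long prefix depends on [u' ++ [:: c]] alone. *)
have tq : top (take (size u).+1 (evac ((b0 :: u') ++ [:: c]))) = top (eta (u' ++ [:: c])).
  rewrite (@top_take _ (eta ((b0 :: u') ++ [:: c]))) ?top_xiw //.
  rewrite -[b0 :: u']cat1s -catA eta_cat take_size_cat //.
  by rewrite size_eta size_cat su' addn1.
have [p [c' [eq sp]]] : exists p c', evac ((b0 :: u') ++ [:: c]) = p ++ [:: c'] /\ size p = (size u).+1.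
  case/lastP: (evac ((b0 :: u') ++ [:: c])) sq => [//|p c']; rewrite size_rcons => -[sp].
  by exists p, c'; rewrite cats1.
rewrite eq take_size_cat // in tq; rewrite eq in hq.
have hp := hw_catl hq; rewrite top_id // in tq.
(* As [p] lies in the component of [eta (u' ++ [:: c])], its dual lies in that of [u' ++ [:: c]],
   where [evac p] is the highest word. *)
have eSp : evac p = top (u' ++ [:: c]).
  rewrite -(top_id n_gt1 (hw_evac hp)) top_xiw tq.
  rewrite -[in RHS](etaK (u' ++ [:: c])); apply: top_eta => //.
  by rewrite top_id //; apply: top_hw.
exists b0, u', c'; split=> //.
- rewrite /bk_op /= step1 step2.
  have step3 : evac_at (size u).+2 ((b0 :: u') ++ c :: r) = p ++ c' :: r.
    have -> : (b0 :: u') ++ c :: r = ((b0 :: u') ++ [:: c]) ++ r by rewrite -catA.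
    have sc : size ((b0 :: u') ++ [:: c]) = (size u).+2.
      by rewrite size_cat /= su' addn1.
    by rewrite /evac_at take_size_cat // drop_size_cat // eq -catA.
  by rewrite step3 /evac_at take_size_cat // drop_size_cat // eSp.
- rewrite -eSp; apply: hw_cat_subst hq; [exact: hw_evac|exact: size_evac|exact: tot_evac].
move=> j jn; rewrite -eSp plc pl_evac // -plc -eq pl_evac // plc pv // -plc.
by rewrite -catA.
Qed.

End Involution.

(** * The local rule *)

Section LocalRule.
Variable n : nat.
Hypothesis n_gt1 : (1 < n)%N.
Notation lword := (seq (letter n)).
Implicit Types (h w x y z t u v : lword) (i j k a : nat) (b c l : letter n).

(* A state on the way from [b0 :: y0] highest to the top of the component of [y0]:
   [b] is lowered and [y] raised along the same simple roots.  The
   backward clause (all ways back from [b] lift to [y]) is what makes the bound on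
   [dep] propagate. *)
Inductive dominated : letter n -> lword -> Prop :=
  Dominated b y of (forall i, dep i y <= Num.max 0 (sg i b))
    & (forall k, sg k b = -1 -> 0 < phi k y)
    & (forall k z, sg k b = -1 -> es k z y -> dominated (flip true k b) z) :
    dominated b y.

Lemma dominated_dep b y i : dominated b y -> dep i y <= Num.max 0 (sg i b).
Proof. by case. Qed.

Lemma dep_big i y : (n <= i)%N -> dep i y = 0.
Proof.
move=> ni; have := dep_ge0 n_gt1 i y; case: (ltP 0 (dep i y)) => d; last by lia.
by have [z /(es_lt n_gt1)] := es_ex n_gt1 d; rewrite ltnNge ni.
Qed.

(** The critical case is an adjacent [k] with [sg k b = -1]: the bound stays 0 while the depth of
    [y] could rise to 1. A square would then make the lowering [z] of [y] at [k] raisable at [i],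
    although the letter [flip true k b] dominating [z] pairs to 0 there. *)
Lemma dominated_raise b y i y' : dominated b y -> sg i b = 1 -> es i y y' ->
  dominated (flip false i b) y'.
Proof.
move=> D; elim: D i y' => {y}b y D1 D2 D3 IH i y' si E.
have hi := es_lt n_gt1 E; have c2 := cart2 n_gt1 hi.
have sgb k : sg k (flip false i b) = sg k b - cart n i k by apply: sg_lower.
have D : dominated b y by constructor.
constructor=> [k|k|k z]; rewrite sgb.
- case: (ltnP k n) => hk; last by rewrite dep_big // le_max lexx.
  have := D1 k; have [ki|ki] := eqVneq i k.
    by subst k; rewrite (es_dep n_gt1 E) si c2; lia.
  have := sg_bound n_gt1 k (flip false i b); rewrite sgb.
  case: (es_dep_other n_gt1 E hk ki) => [[-> ->]|[c0 e]]; first by lia.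
  rewrite c0; have := dep_ge0 n_gt1 k y; have := sg_bound n_gt1 k b.
  case: (eqVneq (sg k b) (-1)) => [sk|]; last by lia.
  case: e => e; first by lia.
  have [z Ez] := fs_ex n_gt1 (D2 k sk).
  have [s Es] : exists s, es k s y'.
    by apply: (fs_ex n_gt1); have := D2 k sk; rewrite /phi (es_tot n_gt1 k E); lia.
  have [|x [E1 E2]] := fs_square n_gt1 E Es ki.
    by left; rewrite /phi (es_tot n_gt1 k E); lia.
  rewrite (es_inj n_gt1 E1 Ez) in E2.
  have := dominated_dep i (D3 k z sk Ez); have := es_dep_gt0 n_gt1 E2.
  rewrite (sg_raise n_gt1) // si.
  by case: (cart_off n_gt1 hi hk ki); lia.
- case: (ltnP k n) => hk; last first.
    by have := sg0 n_gt1 (flip false i b) hk; rewrite sgb => ->.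
  have [ki|ki] := eqVneq i k; first by subst k => _; apply: (es_phi_gt0 n_gt1 E).
  rewrite /phi (es_tot n_gt1 k E).
  case: (es_dep_other n_gt1 E hk ki) => [[-> ->]|[c0 e]].
    by rewrite subr0 addr0; apply: D2.
  by rewrite c0; have := sg_bound n_gt1 k b; lia.
move=> s Ez; have hk := es_lt n_gt1 Ez.
have [ki|ki] := eqVneq i k.
  by subst k; rewrite (es_inj n_gt1 Ez E) (@flipK _ n_gt1 false).
(* For adjacent nodes the hypothesis would give [sg k b = -2]. For orthogonal ones the square
   transfers the claim to the lowering [z0] of [y], covered by induction. *)
have [cik|cik] := cart_off n_gt1 hi hk ki; last first.
  by have := sg_bound n_gt1 k b; lia.
have sk : sg k b = -1 by lia.
have [z0 E0] := fs_ex n_gt1 (D2 k sk).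
have ik : k != i by rewrite eq_sym.
have [t Et] : exists t, es i z0 t.
  apply: (es_ex n_gt1); have := es_dep_gt0 n_gt1 E.
  by case: (es_dep_other n_gt1 E0 hi ik) => [[_ ->]|] //; lia.
have [t' [E1 E2]] := es_square0 n_gt1 Et E0 ki cik.1.
rewrite (es_det n_gt1 E2 E) in E1; rewrite (es_inj n_gt1 E1 Ez) in Et.
have -> := @flip_flipC _ n_gt1 false true _ _ _ hi hk cik.1 cik.2 si sk.
by apply: IH Et => //; rewrite (sg_raise n_gt1) // si; case: cik => _ ->.
Qed.

(** The first letter of a highest word pairs nonnegatively with all coroots, so the clauses about
    [sg k b = -1] hold vacuously and the path condition behind that letter gives the bound. *)
Lemma dominated_hw b y : hw (b :: y) -> dominated b y.
Proof.
move=> /(hw_hgt n_gt1) hh; have s0 i : 0 <= sg i b.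
  by have := hh i 1%N isT; rewrite hgt_cons hgt0 addr0.
constructor=> [i|k s|k z s]; try by have := s0 k; rewrite s.
have [_ [k kw e]] := dep_hgt n_gt1 i y.
by have := hh i k.+1 kw; rewrite hgt_cons e; lia.
Qed.

(* [y] can be raised to the top of its component with the last letter [c] kept
   fixed: every raising operator used has depth at most one on [y ++ [:: c]]. *)
Lemma top_raise_prefix b y c : dominated b y -> dominated b (y ++ [:: c]) ->
  top (y ++ [:: c]) = top (top y ++ [:: c]).
Proof.
elim/(up_ind n_gt1): y b => y IH b D D'.
case: (hwP n_gt1 y) => [hy|[i [y1 E]]]; first by rewrite (top_id n_gt1 hy).
have d0 := es_dep_gt0 n_gt1 E.
have sb := sg_bound n_gt1 i b.
have si : sg i b = 1 by have := dominated_dep i D; lia.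
have E' : es i (y ++ [:: c]) (y1 ++ [:: c]).
  case: E => a E; have ha := estep_dep n_gt1 E; case: E => aw h1 h2 ->.
  have [h3 _] := dep_hgt n_gt1 i (y ++ [:: c]).
  (* The depth of [y] is one and that of [y ++ [:: c]] at most one, so [c] creates no lower minimum
     and the same letter is raised in both words. *)
  have := dominated_dep i D'; rewrite si => d1.
  exists a; split; rewrite ?size_cat; first by lia.
  - move=> k ka; rewrite !hgt_cat aw; case: ifP => [_|]; last by lia.
    exact: h1.
  - move=> k kw; have := h3 k; rewrite size_cat hgt_cat !hgt_cat aw => /(_ kw).
    by lia.
  by rewrite upd_cat aw nth_cat aw.
rewrite (top_es n_gt1 E') (top_es n_gt1 E).
exact: (IH i y1 E (flip false i b) (dominated_raise D si E) (dominated_raise D' si E')).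
Qed.

(* [colsum w k] is the length of the [k]-th column of the diagram attached to
   [w]; [node k] is the simple root pairing as the difference of columns [k] and
   [k.+1], and [node'] is the remaining simple root. *)
Definition node k := if odd n && (k == 0%N) then (n - 1)%N else (n - 2 - k)%N.
Definition colbit l k : int :=
  if odd n && (k == 0%N) then bitz l (n - 1 - k) else 1 - bitz l (n - 1 - k).
Definition colsum w k : int := \sum_(l <- w) colbit l k.

Lemma colsum_cat x y k : colsum (x ++ y) k = colsum x k + colsum y k.
Proof. by rewrite /colsum big_cat. Qed.

Lemma colsum_pl w k : (k < n)%N -> colsum w k =
  if odd n && (k == 0%N) then pl w (n - 1 - k) else (size w)%:Z - pl w (n - 1 - k).
Proof.
move=> kn; rewrite /colsum /pl /colbit; case: (odd n && _) => //.
elim: w => [|l w IH]; first by rewrite !big_nil.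
rewrite !big_cons {}IH; move: (\sum_(_ <- w) _) => s.
by rewrite [size (_ :: _)]/=; lia.
Qed.

Lemma sg_node l k : (k.+1 < n)%N -> sg (node k) l = colbit l k - colbit l k.+1.
Proof.
move=> kn; rewrite /sg /node /colbit andbF.
case: (boolP (odd n && _)) => [/andP[_ /eqP ->]|h].
  have -> : ((n - 1).+1 < n)%N = false by lia.
  have -> : (n - 1).+1 == n by lia.
  have -> : (n - 1 - 1 = n - 2)%N by lia.
  by rewrite subn0; lia.
have -> : ((n - 2 - k).+1 < n)%N by lia.
have -> : ((n - 2 - k).+1 = n - 1 - k)%N by lia.
have -> : (n - 1 - k.+1 = n - 2 - k)%N by lia.
lia.
Qed.

Lemma tot_node w k : (k.+1 < n)%N -> tot (node k) w = colsum w k - colsum w k.+1.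
Proof.
move=> kn; rewrite /tot /colsum -sumrB; apply: eq_bigr => l _; exact: sg_node.
Qed.

Definition node' := if odd n then (n - 2)%N else (n - 1)%N.

Lemma sg_node' l : sg node' l = 1 - colbit l 0 - colbit l 1.
Proof.
rewrite /sg /node' /colbit andbT andbF subn0.
have -> : (n - 1 - 1 = n - 2)%N by lia.
case: (odd n).
  have -> : ((n - 2).+1 < n)%N by lia.
  have -> : (n - 2).+1 = (n - 1)%N by lia.
  lia.
have -> : ((n - 1).+1 < n)%N = false by lia.
have -> : (n - 1).+1 == n by lia.
lia.
Qed.

Lemma tot_node' w : tot node' w = (size w)%:Z - colsum w 0 - colsum w 1.
Proof.
rewrite /tot /colsum; elim: w => [|l w IH]; first by rewrite !big_nil.
rewrite !big_cons {}IH sg_node'.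
by move: (\sum_(_ <- w) _) (\sum_(_ <- w) _) => s s'; rewrite [size (_ :: _)]/=; lia.
Qed.

Lemma node_cover i : (i < n)%N -> i = node' \/ exists2 k, (k.+1 < n)%N & i = node k.
Proof.
move=> hi; rewrite /node' /node; case on: (odd n) => /=.
  case: (eqVneq i (n - 2)%N) => [->|h1]; first by left.
  right; case: (eqVneq i (n - 1)%N) => [->|h2]; first by exists 0%N.
  exists (n - 2 - i)%N; first by lia.
  by case: eqP => ?; lia.
case: (eqVneq i (n - 1)%N) => [->|h1]; first by left.
by right; exists (n - 2 - i)%N; lia.
Qed.

(** The dominant chamber in column lengths: the chain of type A nodes asks for a partition, the
    remaining node for a short one. This is the origin of the condition in [SYD]. *)
Lemma tot_ge0_col w : (forall i, 0 <= tot i w) <->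
  ((forall k, (k.+1 < n)%N -> colsum w k.+1 <= colsum w k) /\ colsum w 0 + colsum w 1 <= (size w)%:Z).
Proof.
split=> [h|[h1 h2] i].
  split=> [k kn|]; first by have := h (node k); rewrite tot_node //; lia.
  by have := h node'; rewrite tot_node'; lia.
case: (ltnP i n) => hi; last by rewrite /tot big1 // => l _; apply: (sg0 n_gt1).
case: (node_cover hi) => [->|[k kn ->]]; first by rewrite tot_node'; lia.
by rewrite tot_node //; have := h1 k kn; lia.
Qed.

Lemma colbit_flip l k a : (k.+1 < n)%N -> (a < n)%N -> sg (node k) l = -1 ->
  colbit (flip true (node k) l) a = colbit l a + (a == k)%:Z - (a == k.+1)%:Z.
Proof.
move=> kn an s; have hk : (node k < n)%N by rewrite /node; case: ifP; lia.
rewrite /colbit !(@bitz_flip _ n_gt1 true) ?s ?expr1 //; try lia.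
rewrite sqrrN expr1n mul1r /sroot /node.
case on: (odd n) => /=; last first.
  have -> : ((n - 2 - k).+1 < n)%N by lia.
  lia.
case: (eqVneq k 0%N) => [->|k0].
  have -> : ((n - 1).+1 < n)%N = false by lia.
  have -> : (n - 1).+1 == n by lia.
  by case: (eqVneq a 0%N) => [->|a0]; lia.
have -> : ((n - 2 - k).+1 < n)%N by lia.
by case: (eqVneq a 0%N) => [->|a0]; lia.
Qed.

Definition cols w : seq int := [seq colsum w k | k <- iota 0 n].

Lemma perm_swap (f g : nat -> int) k : (k.+1 < n)%N -> g k = f k.+1 -> g k.+1 = f k ->
  (forall a, (a < n)%N -> a != k -> a != k.+1 -> g a = f a) ->
  perm_eq [seq g a | a <- iota 0 n] [seq f a | a <- iota 0 n].
Proof.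
move=> kn e1 e2 e3.
have en : n = (k + (2 + (n - k - 2)))%N by lia.
rewrite en !iotaD !map_cat /= add0n e1 e2.
have -> : [seq g a | a <- iota 0 k] = [seq f a | a <- iota 0 k].
  by apply/eq_in_map => a; rewrite mem_iota => ha; apply: e3; lia.
have -> : [seq g a | a <- iota (k + 2) (n - k - 2)] = [seq f a | a <- iota (k + 2) (n - k - 2)].
  by apply/eq_in_map => a; rewrite mem_iota => ha; apply: e3; lia.
by rewrite perm_cat2l; apply: (permEl (perm_catCA [:: _] [:: _] _)).
Qed.

(** At an inversion the total pairing is exactly -1, because [u] contributes at least 0 and the
    letter at least -1. The raising operator then acts on the last letter and exchanges the two
    columns. *)
Lemma sort_last_letter u c : hw u -> exists c',
  [/\ top (u ++ [:: c']) = top (u ++ [:: c]),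
      perm_eq (cols (u ++ [:: c'])) (cols (u ++ [:: c])) &
      forall k, (k.+1 < n)%N -> colsum (u ++ [:: c']) k.+1 <= colsum (u ++ [:: c']) k].
Proof.
move=> hu; move: {2}(u ++ _) (erefl (u ++ [:: c])) => x.
elim/(up_ind n_gt1): x c => x IH c ex; subst x.
case: (boolP (has (fun k => (k.+1 < n)%N && (colsum (u ++ [:: c]) k < colsum (u ++ [:: c]) k.+1)) (iota 0 n))); last first.
  move=> /hasPn h; exists c; split=> // k kn.
  by have := h k; rewrite mem_iota kn /= -leNgt; apply; lia.
case/hasP => k _ /andP[kn lt].
have t0 : 0 <= tot (node k) u.
  by rewrite -hgt_size; apply: (hw_hgt n_gt1 u).1.
have sb := sg_bound n_gt1 (node k) c.
have t1 : tot (node k) u + sg (node k) c < 0.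
  have -> : sg (node k) c = tot (node k) [:: c] by rewrite /tot big_seq1.
  by rewrite -tot_cat tot_node //; lia.
have s : sg (node k) c = -1 by lia.
have E : es (node k) (u ++ [:: c]) (u ++ [:: flip true (node k) c]).
  exists (size u); have hl : hgt (node k) (u ++ [:: c]) (size u).+1 = -1.
    rewrite -[(size u).+1]addn1 -(size_cat u [:: c]) hgt_size tot_cat {2}/tot big_seq1; lia.
  split; rewrite ?size_cat ?addn1 //.
  - move=> a au; rewrite hl hgt_cat au.
    by have := (hw_hgt n_gt1 u).1 hu (node k) a au; lia.
  - move=> a; rewrite leq_eqVlt => /orP[/eqP ->//|au].
    by rewrite hl hgt_cat -ltnS au; have := (hw_hgt n_gt1 u).1 hu (node k) a au; lia.
  by rewrite upd_cat nth_cat ltnn subnn.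
have [c' [h1 h2 h3]] := IH _ _ E _ erefl.
have cE a : (a < n)%N -> colsum (u ++ [:: flip true (node k) c]) a =
    colsum (u ++ [:: c]) a + (a == k)%:Z - (a == k.+1)%:Z.
  by move=> an; rewrite !colsum_cat /colsum !big_seq1 colbit_flip //; lia.
have tn : colsum (u ++ [:: c]) k - colsum (u ++ [:: c]) k.+1 = -1.
  by rewrite -tot_node // tot_cat {2}/tot big_seq1; lia.
exists c'; split=> //; first by rewrite h1 (top_es n_gt1 E).
apply: perm_trans h2 _; apply: (perm_swap kn).
- by rewrite cE ?(ltnW kn) // eqxx; lia.
- by rewrite cE // eqxx; lia.
by move=> a an ak ak'; rewrite cE // (negPf ak) (negPf ak') subr0 addr0.
Qed.

End LocalRule.

(** * Comparison with the operators on raw words *)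

Section Raw.
Variable n : nat.
Hypothesis n_gt1 : (1 < n)%N.
Notation lword := (seq (letter n)).
Implicit Types (h w x y z t u v : lword) (i j k a m : nat) (b c l : letter n) (ws : seq nat).
Notation th := (theta n).

Definition raw w : word := map val w.

Lemma eS_raw i l : eS n i (val l) =
  if sg i l == -1 then Some (val (flip true i l)) else None.
Proof.
have P f s : size s = n -> (forall j, (j < n)%N -> nth false s j = f j) ->
    Some s = Some (val (mkletter n f)).
  move=> sz e; congr Some; apply: (@eq_from_nth _ false) => [|j].
    by rewrite sz size_tuple.
  by rewrite sz => jn; rewrite e // -(bit_mk f jn).
rewrite /eS /sg /bitz /bit; case: ifP => h1.
  case b1: (nth false l i); case b2: (nth false l i.+1) => //=.
  apply: P => [|j jn]; first by rewrite !size_set_nth size_tuple; lia.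
  by rewrite !nth_set_nth /= nth_set_nth /= h1; do ?case: eqVneq => // ?; lia.
case: ifP => h2 //.
case b1: (nth false l (n - 2)); case b2: (nth false l (n - 1)) => //=.
apply: P => [|j jn]; first by rewrite !size_set_nth size_tuple; lia.
by rewrite !nth_set_nth /= nth_set_nth /= h1; do ?case: eqVneq => // ?; lia.
Qed.

Lemma fS_raw i l : fS n i (val l) =
  if sg i l == 1 then Some (val (flip false i l)) else None.
Proof.
have P f s : size s = n -> (forall j, (j < n)%N -> nth false s j = f j) ->
    Some s = Some (val (mkletter n f)).
  move=> sz e; congr Some; apply: (@eq_from_nth _ false) => [|j].
    by rewrite sz size_tuple.
  by rewrite sz => jn; rewrite e // -(bit_mk f jn).
rewrite /fS /sg /bitz /bit; case: ifP => h1.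
  case b1: (nth false l i); case b2: (nth false l i.+1) => //=.
  apply: P => [|j jn]; first by rewrite !size_set_nth size_tuple; lia.
  by rewrite !nth_set_nth /= nth_set_nth /= h1; do ?case: eqVneq => // ?; lia.
case: ifP => h2 //.
case b1: (nth false l (n - 2)); case b2: (nth false l (n - 1)) => //=.
apply: P => [|j jn]; first by rewrite !size_set_nth size_tuple; lia.
by rewrite !nth_set_nth /= nth_set_nth /= h1; do ?case: eqVneq => // ?; lia.
Qed.

Lemma phiS_raw i l : (phiS n i (val l))%:Z = Num.max 0 (sg i l).
Proof.
rewrite /phiS /= fS_raw; have := sg_bound n_gt1 i l; case: eqP => [s|]; last by lia.
have hi : (i < n)%N by case: (ltnP i n) => // /(sg0 n_gt1 l); lia.
by rewrite fS_raw (sg_lower n_gt1) // s (cart2 n_gt1).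
Qed.

Lemma dep_le_size i w : dep i w <= (size w)%:Z.
Proof.
elim: w => [//|l w IH]; rewrite [dep _ _]/= -/(dep i w) [size _]/=.
by have := sg_bound n_gt1 i l; lia.
Qed.

Lemma es_cons_tail i b u u' : Num.max 0 (sg i b) < dep i u -> es i u u' ->
  es i (b :: u) (b :: u').
Proof.
move=> lt [a E]; have d := estep_dep n_gt1 E; case: E => aw h1 h2 ->.
exists a.+1; split=> //.
  by case=> [|k] ka; rewrite !hgt_cons ?hgt0; [lia|have := h1 k ka; lia].
by case=> [|k] ka; rewrite !hgt_cons ?hgt0; [lia|have := h2 k ka; lia].
Qed.

Lemma es_cons_head i b u : dep i u <= 0 -> sg i b = -1 ->
  es i (b :: u) (flip true i b :: u).
Proof.
move=> d s; have [h1 _] := dep_hgt n_gt1 i u; exists 0%N; split=> //.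
  by case=> // _; rewrite hgt_cons !hgt0 s.
case=> [|k] ku; rewrite !hgt_cons !hgt0 s //.
by have := h1 k ku; lia.
Qed.

Definition raises (m : nat) := forall i w, size w = m ->
  (forall w', es i w w' -> eW n m i (raw w) = Some (raw w')) /\
  (dep i w = 0 -> eW n m i (raw w) = None).

Lemma cnt_raw m i w k : raises m -> size w = m -> dep i w <= k%:Z ->
  (cnt (eW n m i) k (raw w))%:Z = dep i w.
Proof.
move=> R; elim: k w => [|k IH] w sw dk; first by have := dep_ge0 n_gt1 i w; rewrite /=; lia.
have [R1 R2] := R i w sw; rewrite /=.
case: (ltP 0 (dep i w)) => d; last first.
  have d0 : dep i w = 0 by have := dep_ge0 n_gt1 i w; lia.
  by rewrite R2 // d0.
have [w' E] := es_ex n_gt1 d; rewrite (R1 _ E).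
have := IH w'; rewrite (es_size n_gt1 E) (es_dep n_gt1 E) => /(_ sw); lia.
Qed.

Lemma cnt_size m i w : raises m -> size w = m ->
  (cnt (eW n m i) m.+1 (raw w))%:Z = dep i w.
Proof. by move=> R sw; apply: cnt_raw => //; have := dep_le_size i w; lia. Qed.

(** The test of the tensor product rule asks whether the path of [b :: u] has its first negative
    minimum inside [u]. If not, that minimum is either at the first letter or absent, according to
    [sg i b]. *)
Lemma eW_raw m : raises m.
Proof.
elim: m => [|m IH] i [|b u] //; first by move=> _; split=> // w' /(es_dep_gt0 n_gt1).
move=> [su]; have cE := cnt_size i IH su; have pE := phiS_raw i b.
have -> : eW n m.+1 i (raw (b :: u)) =
  if (phiS n i (val b) < cnt (eW n m i) m.+1 (raw u))%N
  then omap (cons (val b)) (eW n m i (raw u))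
  else omap (fun b' : spin => b' :: raw u : word) (eS n i (val b)) by [].
rewrite -ltz_nat cE pE eS_raw [dep _ (_ :: _)]/= -/(dep i u).
have [R1 R2] := IH i u su; have d0 := dep_ge0 n_gt1 i u.
case: ltP => lt.
  have [u' E] : exists u', es i u u' by apply: (es_ex n_gt1); lia.
  rewrite (R1 _ E); split=> [w' E'|]; last by lia.
  by rewrite (es_det n_gt1 E' (es_cons_tail lt E)).
case: eqP => sb; last first.
  split=> [w' /(es_dep_gt0 n_gt1)|//]; rewrite [dep _ _]/= -/(dep i u).
  by have := sg_bound n_gt1 i b; lia.
split=> [w' E'|]; last by lia.
have E := @es_cons_head i b u ltac:(lia) sb.
by rewrite (es_det n_gt1 E' E).
Qed.

Definition lowers (m : nat) := forall i w, size w = m ->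
  (forall w', es i w' w -> fW n m i (raw w) = Some (raw w')) /\
  (phi i w = 0 -> fW n m i (raw w) = None).

Lemma fW_raw m : lowers m.
Proof.
elim: m => [|m IH] i [|b u] //; first by move=> _; split=> // w' /(es_phi_gt0 n_gt1); rewrite /phi /tot big_nil.
move=> [su]; have cE := cnt_size i (@eW_raw m) su; have pE := phiS_raw i b.
have -> : fW n m.+1 i (raw (b :: u)) =
  if (phiS n i (val b) <= cnt (eW n m i) m.+1 (raw u))%N
  then omap (cons (val b)) (fW n m i (raw u))
  else omap (fun b' : spin => b' :: raw u : word) (fS n i (val b)) by [].
rewrite -lez_nat cE pE fS_raw.
have pc : phi i (b :: u) = Num.max 0 (dep i u - sg i b) + (sg i b + tot i u).
  by rewrite /phi /tot big_cons.
have [R1 R2] := IH i u su; have d0 := dep_ge0 n_gt1 i u; have p0 := phi_ge0 n_gt1 i u.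
rewrite /phi in p0; case: leP => le.
  case: (ltP 0 (phi i u)) => p1.
    have [u' E] := fs_ex n_gt1 p1; rewrite (R1 _ E); split=> [w' E'|].
      have E2 : es i (b :: u') (b :: u).
        have dE := es_dep n_gt1 E.
        by apply: es_cons_tail E; lia.
      by rewrite (es_inj n_gt1 E' E2).
    by rewrite pc; rewrite /phi in p1; lia.
  rewrite R2; last by rewrite /phi in p1 *; lia.
  by split=> // w' /(es_phi_gt0 n_gt1); rewrite pc; rewrite /phi in p1; lia.
have sb : sg i b = 1 by have := sg_bound n_gt1 i b; lia.
have hi : (i < n)%N by case: (ltnP i n) => // /(sg0 n_gt1 b); lia.
rewrite sb eqxx; split=> [w' E'|]; last by rewrite pc; lia.
have sb' : sg i (flip false i b) = -1 by rewrite (sg_lower n_gt1) // sb (cart2 n_gt1).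
have E := @es_cons_head i _ u ltac:(lia) sb'.
rewrite (@flipK _ n_gt1 false) // in E.
by rewrite (es_inj n_gt1 E' E).
Qed.

Lemma size_raw w : size (raw w) = size w.
Proof. exact: size_map. Qed.

Lemma eWordP i w (x : word) : eWord n i (raw w) = Some x <-> exists2 w', es i w w' & x = raw w'.
Proof.
rewrite /eWord size_raw; have [R1 R2] := eW_raw i (erefl (size w)).
split=> [e|[w' E ->]]; last exact: R1.
case: (ltP 0 (dep i w)) => d; last first.
  by move: e; rewrite R2 //; have := dep_ge0 n_gt1 i w; lia.
have [w' E] := es_ex n_gt1 d; exists w' => //.
by move: e; rewrite (R1 _ E) => -[].
Qed.

Lemma fWordP i w (x : word) : fWord n i (raw w) = Some x <-> exists2 w', es i w' w & x = raw w'.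
Proof.
rewrite /fWord size_raw; have [R1 R2] := fW_raw i (erefl (size w)).
split=> [e|[w' E ->]]; last exact: R1.
case: (ltP 0 (phi i w)) => d; last first.
  by move: e; rewrite R2 //; have := phi_ge0 n_gt1 i w; lia.
have [w' E] := fs_ex n_gt1 d; exists w' => //.
by move: e; rewrite (R1 _ E) => -[].
Qed.

Lemma raw_inj : injective raw.
Proof. by apply: inj_map; apply: val_inj. Qed.

Fixpoint up ws h x : Prop :=
  if ws is i :: ws' then exists2 y, up ws' h y & es i y x else x = h.

Lemma up_fun ws h x y : up ws h x -> up ws h y -> x = y.
Proof.
elim: ws x y => [|i ws IH] x y /=; first by move=> -> ->.
by move=> [z d E] [z' d' E']; rewrite (IH _ _ d' d) in E'; apply: (es_det n_gt1 E E').
Qed.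

Lemma applyOps_down ws h (x : word) : applyOps (fWord n) ws (raw h) = Some x <->
  exists2 x', down ws h x' & x = raw x'.
Proof.
elim: ws x => [|i ws IH] x /=.
  by split=> [[<-]|[x' -> ->]] //; exists h.
split.
  case e: (applyOps _ _ _) => [y|] //=.
  have [y' d ->] := (IH y).1 e.
  by move=> /fWordP[x' E ->]; exists x' => //; exists y'.
case=> x' [y d E] ->.
have -> /= : applyOps (fWord n) ws (raw h) = Some (raw y) by apply/IH; exists y.
by apply/fWordP; exists x'.
Qed.

Lemma applyOps_up ws h (x : word) : applyOps (eWord n) ws (raw h) = Some x <->
  exists2 x', up ws h x' & x = raw x'.
Proof.
elim: ws x => [|i ws IH] x /=.
  by split=> [[<-]|[x' -> ->]] //; exists h.
split.
  case e: (applyOps _ _ _) => [y|] //=.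
  have [y' d ->] := (IH y).1 e.
  by move=> /eWordP[x' E ->]; exists x' => //; exists y'.
case=> x' [y d E] ->.
have -> /= : applyOps (eWord n) ws (raw h) = Some (raw y) by apply/IH; exists y.
by apply/eWordP; exists x'.
Qed.

Lemma highestP w : reflect (hw w) (highest n (raw w)).
Proof.
apply: (iffP allP) => [h|h i _].
  case: (hwP n_gt1 w) => // -[i [y E]].
  have := h i; rewrite mem_iota (es_lt n_gt1 E) => /(_ isT) /eqP.
  by rewrite (eWordP i w (raw y)).2 //; exists y.
case e: (eWord n i (raw w)) => [x|] //.
by have [w' /(hw_es n_gt1 h)] := (eWordP _ _ _).1 e.
Qed.

Lemma lowestP w : lowest n (raw w) <-> (forall i z, ~ es i z w).
Proof.
split=> [/allP h i z E|h].
  have := h i; rewrite mem_iota (es_lt n_gt1 E) => /(_ isT) /eqP.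
  by rewrite (fWordP i w (raw z)).2 //; exists z.
apply/allP => i _; case e: (fWord n i (raw w)) => [x|] //.
by have [w' /h] := (fWordP _ _ _).1 e.
Qed.

Lemma validP m (w : word) : valid_word n m w <-> exists2 w', size w' = m & w = raw w'.
Proof.
split=> [/andP[/eqP sw /allP h]|[w' sw ->]]; last first.
  rewrite /valid_word size_raw sw eqxx; apply/allP => s /mapP[l _ ->].
  by rewrite size_tuple.
elim: w m sw h => [|s w IH] m /= sw h; first by exists [::].
have [|w' sw' ew] := IH (size w) erefl; first by move=> t tw; apply: h; rewrite inE tw orbT.
have /h ss : s \in s :: w by rewrite inE eqxx.
by exists (Tuple ss :: w'); rewrite /= ?sw' // -ew.
Qed.

(** * Identification of the involution and of the cactus generators *)

Lemma xiw_down ws h x : down ws h x -> up (map th ws) (xiw h) (xiw x).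
Proof.
elim: ws x => [|i ws IH] x /=; first by move=> ->.
by case=> y /IH d E; exists (xiw y) => //; apply: xiw_es.
Qed.

(** [xiw] exchanges lowest and highest elements, so uniqueness of the top yields uniqueness of the
    bottom. *)
Lemma xiw_lowest h (l : lword) ws : hw h -> down ws h l -> (forall i z, ~ es i z l) -> l = xiw h.
Proof.
move=> hh d low; rewrite -[LHS](xiwK n_gt1); congr xiw.
have hl : hw (xiw l).
  case: (hwP n_gt1 (xiw l)) => // -[i [y /(xiw_es n_gt1)]].
  by rewrite xiwK // => /low.
by rewrite -(top_id n_gt1 hl) top_xiw // (topE n_gt1 hh d).
Qed.

(** In the defining relation the lowest element is forced and a sequence of raisings has at most one
    result, so the choice operator can only return [xiw b]. *)
Lemma xi_raw (b : lword) : xi n (raw b) = raw (xiw b).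
Proof.
have spec : xi_spec n (raw b) (raw (xiw b)).
  have [ws d] := top_down n_gt1 b; have [ws' d'] := top_down n_gt1 (xiw (top b)).
  rewrite (top_xiw n_gt1) (top_id n_gt1 (top_hw n_gt1 b)) in d'.
  exists ws, ws', (raw (top b)), (raw (xiw (top b))); split.
  - apply/andP; split; last by apply/highestP; apply: top_hw.
    by apply/validP; exists (top b); rewrite // size_raw size_top.
  - by apply/applyOps_down; exists b.
  - by apply/applyOps_down; exists (xiw (top b)).
  - apply/lowestP => i z /(xiw_es n_gt1); rewrite xiwK //.
    exact: (hw_es n_gt1 (top_hw n_gt1 b)).
  apply/applyOps_up; exists (xiw b) => //.
  exact: xiw_down.
have := epsilon_spec (inhabits (raw b)) (xi_spec n (raw b)) (ex_intro _ _ spec).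
rewrite -/(xi n (raw b)).
move=> [ws [ws' [h0 [l0' [/andP[/validP[h _ ->] /highestP hh]]]]]].
move=> /applyOps_down[b1 d /raw_inj eb] /applyOps_down[l d' ->] /lowestP low.
move=> /applyOps_up[x u ->]; subst b1; congr raw.
by apply: (up_fun u); rewrite (xiw_lowest hh d' low); apply: xiw_down.
Qed.

Lemma comm_raw (a b : lword) : comm n (raw a) (raw b) = raw (xiw (xiw b ++ xiw a)).
Proof. by rewrite /comm !xi_raw -map_cat -/(raw _) xi_raw. Qed.

(** In the commutor, [xiw] cancels against the [xiw] in the evacuated tail and leaves [eta y]; with
    [eta] of the first letter this is [eta] of the whole factor, and the outer [xiw] completes
    [evac]. The prefix [x] is arbitrary because the recursion moves the starting position. *)
Lemma sgen_raw d x y z : size y = d.+1 ->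
  sgen n (size x).+1 d (raw (x ++ y ++ z)) = raw (x ++ evac y ++ z).
Proof.
elim: d x y => [|d IH] x [|b y] // [sy].
  by rewrite evac1 //= sy.
have -> : sgen n (size x).+1 d.+1 (raw (x ++ (b :: y) ++ z)) =
  sigma3 n (size x).+1 (size x).+1 ((size x).+1 + d.+1)
    (sgen n (size x).+2 d (raw (x ++ (b :: y) ++ z))) by [].
have := IH (x ++ [:: b]) y sy; rewrite size_cat addn1 -!catA => ->.
have e2 : ((size x).+1 + d.+1 - (size x).+1.-1)%N = size (b :: evac y).
  by rewrite /= size_evac // sy; lia.
have e3 : ((size x).+1 + d.+1)%N = size (x ++ b :: evac y).
  by rewrite size_cat /= size_evac // sy; lia.
have e4 : ((size x).+1 - (size x).+1.-1 = 1)%N by lia.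
have t1 : take (size (b :: evac y)) (b :: evac y ++ z) = b :: evac y.
  by rewrite -cat_cons take_size_cat.
have t2 : drop (size (x ++ b :: evac y)) (x ++ b :: evac y ++ z) = z.
  by rewrite -cat_cons catA drop_size_cat.
rewrite /sigma3 e2 e3 e4 [(size x).+1.-1]/= cat1s /raw -!map_drop -!map_take -!map_drop.
rewrite t2 take_size_cat // drop_size_cat // t1 /= take0 drop0.
rewrite -/(raw (evac y)) -[[:: val b]]/(raw [:: b]) comm_raw -!map_cat /raw.
by rewrite /evac (xiwK n_gt1) xiw1 // -eta_cat.
Qed.

Lemma s_raw k w : (0 < k <= size w)%N -> s n 1 k (raw w) = raw (evac_at k w).
Proof.
move=> /andP[k0 kw]; rewrite /s /evac_at -{1}(cat_take_drop k w).
by apply: (@sgen_raw _ [::]); rewrite size_takel //; lia.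
Qed.

Lemma size_evac_at k w : size (evac_at k w) = size w.
Proof. by rewrite /evac_at size_cat size_evac // -size_cat cat_take_drop. Qed.

Lemma evac_at1 w : evac_at 1 w = w.
Proof.
rewrite /evac_at; case: w => [|l w]; first by rewrite evac0.
by rewrite evac1 //= ?take0 ?drop0.
Qed.

Lemma T_raw i w : (0 < i < size w)%N -> T n i (raw w) = raw (bk_op i w).
Proof.
move=> /andP[i0 iw]; rewrite /T /bk_op.
case: eqP => [->|i1] /=.
  rewrite s_raw; last by lia.
  by rewrite !evac_at1 /evac_at take0 drop0 evac0.
case: eqP => [->|i2] /=.
  by rewrite evac_at1 !s_raw ?size_evac_at //; lia.
by rewrite !s_raw ?size_evac_at //; lia.
Qed.

End Raw.

(** * The Bender-Knuth involution on tableaux *)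

Local Close Scope ring_scope.

Lemma count_le_sorted (s : seq nat) r k : sorted leq s -> k < size s ->
  (count (fun v => v <= r) s <= k) = (r < nth 0 s k).
Proof.
elim: s k => [|v s IH] //= k sv ks.
have all_v : all (leq v) s by apply: (order_path_min leq_trans).
have ss := path_sorted sv.
case: (leqP v r) => vr.
  by case: k ks => [|k] ks /=; [rewrite ltnNge vr|rewrite add1n ltnS IH].
have -> : count (leq^~ r) s = 0.
  apply/eqP; rewrite eqn0Ngt -has_count; apply/hasPn => y /(allP all_v) vy /=.
  by rewrite -ltnNge; apply: leq_trans vy.
rewrite addn0; apply/esym; case: k ks => [|k] ks //=; apply: leq_trans vr _.
by apply: (allP all_v); apply: mem_nth.
Qed.

Lemma count_iota_lt m k : count (fun r => r < k) (iota 0 m) = minn k m.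
Proof.
elim: m => [|m IH]; first by rewrite minn0.
by rewrite -addn1 iotaD count_cat IH /=; case: ltnP; lia.
Qed.

Lemma count_index_lt (T : eqType) (s : seq T) k : uniq s -> k <= size s ->
  count (fun c => index c s < k) s = k.
Proof.
move=> us ks; have -> : count (fun c => index c s < k) s = count (fun r => r < k) [seq index c s | c <- s].
  by rewrite count_map.
have -> : [seq index c s | c <- s] = iota 0 (size s).
  apply: (@eq_from_nth _ 0) => [|j]; first by rewrite size_map size_iota.
  rewrite size_map => js; rewrite nth_iota // add0n.
  case: s us ks js => // t s us ks js.
  by rewrite (nth_map t) // index_uniq.
by rewrite count_iota_lt; apply/minn_idPl.
Qed.

Section BenderKnuth.
Variables (n i : nat) (x : seq diagram).
Let X k c := nth 0 (nth [::] x k) c.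
Hypotheses (i_gt0 : 0 < i) (i_lt : i < size x).
Hypothesis X0 : forall c, c < n -> X 0 c <= 1.
Hypothesis XS : forall k c, k.+1 < size x -> c < n -> X k c <= X k.+1 c <= (X k c).+1.
(** The list is 0-based: [K], [M], [V] are the column lengths after steps [i - 1], [i], [i + 1], and
    the empty diagram before the first step is not in the list. *)
Let K c := if i == 1 then 0 else X (i - 2) c.
Let M c := X (i - 1) c.
Let V c := X i c.

Lemma X_mono k k' c : c < n -> k <= k' -> k' < size x -> X k c <= X k' c.
Proof.
move=> cn; elim: k' => [|k' IH]; first by rewrite leqn0 => /eqP ->.
rewrite leq_eqVlt => /orP[/eqP -> //|kk] ks.
by apply: (leq_trans (IH kk (ltnW ks))); case/andP: (XS ks cn).
Qed.

Lemma KMV c : c < n -> K c <= M c <= (K c).+1 /\ M c <= V c <= (M c).+1.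
Proof.
move=> cn; rewrite /K /M /V; split.
  case: (eqVneq i 1) => [->|i1]; first by rewrite subnn /= X0.
  have -> : i - 1 = (i - 2).+1 by lia.
  by apply: XS => //; lia.
have := @XS (i - 1) c; rewrite subn1 prednK //; exact.
Qed.

Lemma entry_le r c k : c < n -> k < size x -> (entry x r c <= k.+1) = (r < X k c).
Proof.
move=> cn kx; rewrite /entry ltnS.
have e : count (fun d : diagram => nth 0 d c <= r) x = count (fun v => v <= r) [seq nth 0 d c | d <- x].
  by rewrite count_map.
rewrite e count_le_sorted ?size_map // ?(nth_map [::]) //.
apply/(sortedP 0) => j; rewrite size_map => js; rewrite !(nth_map [::]) //; last by lia.
by case/andP: (XS js cn).
Qed.

Lemma last_ge c : c < n -> V c <= nth 0 (nth [::] x (size x).-1) c.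
Proof. by move=> cn; apply: X_mono => //; lia. Qed.

Lemma entry_lt r c : c < n -> (entry x r c < i) = (r < K c).
Proof.
move=> cn; rewrite /K; case: (eqVneq i 1) => [->|i1].
  by rewrite ltn0 /entry.
by rewrite -(@entry_le r c (i - 2)) //; lia.
Qed.

Lemma entry_le_i r c : c < n -> (entry x r c <= i) = (r < M c).
Proof. by move=> cn; rewrite /M -(@entry_le r c (i - 1)) //; lia. Qed.

Lemma in_skewE r c : c < n -> in_skew i x r c = (K c <= r < V c).
Proof.
move=> cn; rewrite /in_skew; have := last_ge cn.
have := entry_lt r cn; have := @entry_le r c i cn i_lt; rewrite -/(V c).
set e := entry x r c; lia.
Qed.

(** The skew cells of column [c] fill the rows from [K c] up to [V c], so a free cell is the case of
    exactly one row. *)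
Lemma freeE r c : c < n -> Defs.free i x r c = (K c == r) && (V c == r.+1).
Proof.
move=> cn; rewrite /Defs.free in_skewE //; have [h1 h2] := KMV cn; have h3 := last_ge cn.
apply/idP/idP => [/andP[rV /hasPn h]|h].
  have h' r' : K c <= r' -> r' < V c -> r' == r.
    move=> a1 a2; have := h r'; rewrite mem_iota in_skewE // => /(_ ltac:(lia)).
    by rewrite a1 a2 /= andbT negbK.
  by have := h' (K c); have := h' (K c).+1; lia.
apply/andP; split; first by lia.
apply/hasPn => r' _; rewrite in_skewE //; lia.
Qed.

Let fc r := [seq c <- iota 0 n | Defs.free i x r c].
Let nc r := count (fun c => entry x r c == i.+1) (fc r).
Let D c := count (fun r => new_entry n i x r c <= i) (iota 0 (nth 0 (nth [::] x (size x).-1) c)).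

Lemma D_free c : c < n -> V c = (K c).+1 -> D c = K c + (index c (fc (K c)) < nc (K c)).
Proof.
move=> cn e; have h3 := last_ge cn; rewrite /D.
set m := nth 0 _ c in h3 *.
have -> : m = K c + (1 + (m - (K c).+1)) by lia.
rewrite !iotaD !count_cat /= !add0n addn0.
have -> : count (fun r => new_entry n i x r c <= i) (iota 0 (K c)) = K c.
  rewrite -[RHS](size_iota 0 (K c)); apply/eqP; rewrite -all_count; apply/allP => r.
  rewrite mem_iota => /andP[_ rK]; rewrite /new_entry freeE //.
  rewrite ifN; last by lia.
  by rewrite entry_le_i //; have := KMV cn; lia.
have -> : count (fun r => new_entry n i x r c <= i) (iota (K c + 1) (m - (K c).+1)) = 0.
  apply/eqP; rewrite -leqn0 leqNgt -has_count; apply/hasPn => r.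
  rewrite mem_iota => rK; rewrite /new_entry freeE //.
  rewrite ifN; last by lia.
  by rewrite entry_le_i //; have := KMV cn; lia.
rewrite addn0; congr (_ + _); rewrite /new_entry freeE // eqxx e eqxx /=.
by rewrite -/(fc _) -/(nc _); case: ifP; rewrite ?leqnn ?ltnn.
Qed.

Lemma D_nonfree c : c < n -> V c != (K c).+1 -> D c = M c.
Proof.
move=> cn e; have h3 := last_ge cn; have [h1 h2] := KMV cn; rewrite /D.
set m := nth 0 _ c in h3 *.
rewrite (@eq_count _ _ (fun r => r < M c)) ?count_iota_lt; first by apply/minn_idPl; lia.
move=> r; rewrite /new_entry freeE // ifN ?entry_le_i //; lia.
Qed.

Lemma count_add3 (T : eqType) (P A B C : pred T) (s : seq T) :
  {in s, forall c, P c = A c + B c + C c :> nat} ->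
  count P s = count A s + count B s + count C s.
Proof.
elim: s => [|c s IH] //= H; rewrite IH => [|c' cs]; last by apply: H; rewrite inE cs orbT.
by rewrite H ?mem_head //; lia.
Qed.

(** Columns of length [v] are non-free, or free in row [v] without the extra cell, or free in row
    [v - 1] with it. Only the number of extra cells in each row matters, which allows two different
    choices of [t] to be compared. *)
Lemma count_val (f : nat -> nat) (t : pred nat) v :
  (forall c, c < n -> V c != (K c).+1 -> f c = M c) ->
  (forall c, c < n -> V c = (K c).+1 -> f c = K c + t c) ->
  count (pred1 v) [seq f c | c <- iota 0 n] =
  count (fun c => (V c != (K c).+1) && (M c == v)) (iota 0 n) +
  count (predC t) (fc v) + (if v is r.+1 then count t (fc r) else 0).
Proof.
move=> f1 f2; rewrite count_map /fc.
have -> : (if v is r.+1 then count t [seq c <- iota 0 n | Defs.free i x r c] else 0) =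
    count (fun c => if v is r.+1 then t c && Defs.free i x r c else false) (iota 0 n).
  by case: v => [|r]; rewrite ?count_pred0 // count_filter.
rewrite count_filter; apply: count_add3 => c; rewrite mem_iota => /= cn.
have e : (V c = (K c).+1) \/ (V c != (K c).+1) by case: eqP; [left|right].
case: v e => [|v] e; rewrite !freeE //.
  by case: e => e; [rewrite f2 // e|rewrite f1 //]; case: (t c); lia.
by case: e => e; [rewrite f2 // e|rewrite f1 //]; case: (t c); lia.
Qed.

(* In row [r] the number of free columns growing by one at step [i] is the same
   for both diagrams. *)
Lemma perm_new_diag : perm_eq (new_diag n i x) [seq K c + V c - M c | c <- iota 0 n].
Proof.
have fcP r c : c \in fc r -> c < n /\ K c = r.
  by rewrite mem_filter mem_iota => /andP[h] /= cn; split=> //; move: h; rewrite freeE //; lia.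
have e1 r : count (fun c => index c (fc (K c)) < nc (K c)) (fc r) = nc r.
  rewrite -[RHS](@count_index_lt _ (fc r)) ?filter_uniq ?iota_uniq ?count_size //.
  by apply: eq_in_count => c /fcP[_ ->].
have e2 r : count (fun c => M c == K c) (fc r) = nc r.
  apply: eq_in_count => c; rewrite mem_filter mem_iota => /andP[h] /= cn.
  move: h; rewrite freeE // => /andP[/eqP Kr Vr].
  have [h1 h2] := KMV cn; have := @entry_le r c i cn i_lt; rewrite -/(V c).
  have := entry_le_i r cn; lia.
have e3 (t : pred nat) r : count (predC t) (fc r) = size (fc r) - count t (fc r).
  by rewrite -(count_predC t (fc r)) addKn.
have perm : perm_eq [seq D c | c <- iota 0 n] [seq K c + V c - M c | c <- iota 0 n].
  apply/allP => v _ /=; apply/eqP.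
  rewrite (count_val v D_nonfree (t := fun c => index c (fc (K c)) < nc (K c)) D_free).
  (* A non-free column has [V] equal to [K] or [K + 2], whence [K + V - M = M]; on a free column
     [K + V - M] exceeds [K] exactly when [M = K]. *)
  rewrite (@count_val _ (fun c => M c == K c)).
  - by rewrite !e3; case: v => [|v]; rewrite !(e1, e2).
  - by move=> c cn h; have := KMV cn; lia.
  by move=> c cn h; have := KMV cn; case: eqP; lia.
exact: perm.
Qed.

End BenderKnuth.

Local Open Scope ring_scope.

(** * Diagrams and dominance in terms of highest words *)

Section Tableaux.
Variable n : nat.
Hypothesis n_gt1 : (1 < n)%N.
Notation lword := (seq (letter n)).
Implicit Types (w u r : lword) (i j k : nat) (b c : letter n).

Lemma plusc_raw w j : (plusc (raw w) j)%:Z = pl w j.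
Proof.
rewrite /plusc /pl /raw count_map; elim: w => [|l w IH]; first by rewrite big_nil.
by rewrite big_cons -IH /bitz /bit /=; case: (nth _ _ _); lia.
Qed.

Lemma minusc_raw w j : (minusc (raw w) j)%:Z = (size w)%:Z - pl w j.
Proof.
rewrite -plusc_raw /minusc /plusc -(size_raw w) -(count_predC (fun s => nth false s j) (raw w)).
by rewrite (@eq_count _ (predC _) (fun s => ~~ nth false s j)) //; lia.
Qed.

Lemma gamma2_raw w j : gamma2 (raw w) j = 2 * pl w j - (size w)%:Z.
Proof. by rewrite /gamma2 minusc_raw plusc_raw; lia. Qed.

Lemma diag_nth w k : (k < n)%N -> (nth 0%N (diag_of n (raw w)) k)%:Z = colsum w k.
Proof.
move=> kn; rewrite /diag_of (nth_map 0%N) ?size_rev ?size_iota // nth_rev ?size_iota //.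
rewrite nth_iota ?add0n; last by lia.
rewrite colsum_pl //; have -> : (n - k.+1 == n.-1)%N = (k == 0%N) by lia.
have -> : (n - k.+1 = n - 1 - k)%N by lia.
by case: ifP => _; rewrite ?plusc_raw ?minusc_raw.
Qed.

Lemma size_diag (p : word) : size (diag_of n p) = n.
Proof. by rewrite size_map size_rev size_iota. Qed.

Lemma diag_eq w (d : diagram) : size d = n ->
  (forall k, (k < n)%N -> (nth 0%N d k)%:Z = colsum w k) -> diag_of n (raw w) = d.
Proof.
move=> sd e; apply: (@eq_from_nth _ 0%N) => [|k]; rewrite size_diag ?sd // => kn.
by have := diag_nth w kn; rewrite -e //; lia.
Qed.

Lemma dominantP w : dominant2 n (raw w) <-> forall i, 0 <= tot i w.
Proof.
split=> [/andP[/allP h1 h2] i|h].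
  rewrite tot_pl // /pair_vec; case: ifP => hi.
    by have := h1 i; rewrite mem_iota !gamma2_raw => /(_ ltac:(lia)); lia.
  by case: ifP => // _; move: h2; rewrite !gamma2_raw; lia.
apply/andP; split.
  apply/allP => j; rewrite mem_iota => jn; rewrite !gamma2_raw.
  by have := h j; rewrite tot_pl // /pair_vec ifT; lia.
have := h (n - 1)%N; rewrite tot_pl // /pair_vec ifN ?ifT; try lia.
by rewrite !gamma2_raw; lia.
Qed.

Lemma TN_raw N w : TN n N (raw w) <-> size w = N /\ hw w.
Proof.
split=> [/andP[/validP[w' sw /raw_inj ->] /allP h]|[sw h]].
  split=> //; apply/(hw_hgt n_gt1) => i [|k] kw; first by rewrite hgt0.
  have := h k.+1; rewrite mem_iota -sw => /(_ ltac:(lia)).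
  by rewrite /raw -map_take => /dominantP /(_ i).
apply/andP; split; first by apply/validP; exists w.
apply/allP => k; rewrite mem_iota => kN; rewrite /raw -map_take; apply/dominantP => i.
by apply: (hw_hgt n_gt1 w).1 => //; lia.
Qed.

(** Two decreasing arrangements of the same column lengths coincide, so sorting produces [d] itself.
    Shortness of [d] supplies the last dominance condition, and thus the sorted word is already the
    top of its component. *)
Lemma bk_op_sorted u b c r (d : diagram) : hw (u ++ [:: b; c]) ->
  SYD (size u).+1 n d -> perm_eq (map Posz d) (cols (u ++ [:: c])) ->
  exists c1 c2, [/\ bk_op (size u).+1 (u ++ [:: b, c & r]) = u ++ [:: c1, c2 & r],
    diag_of n (raw (u ++ [:: c1])) = d, hw (u ++ [:: c1; c2]) &
    forall j, (j < n)%N -> pl (u ++ [:: c1; c2]) j = pl (u ++ [:: b; c]) j].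
Proof.
move=> h /and3P[/eqP sd /allP d1 d2] pd; have hu := hw_catl n_gt1 h.
have [b0 [u' [c2 [e1 [su' tu'] [h1 h2] h3 h4]]]] := bk_op_hw n_gt1 r h.
have eT : top (u' ++ [:: c]) = top (u ++ [:: c]).
  by rewrite (top_raise_prefix n_gt1 (dominated_hw n_gt1 h1) (dominated_hw n_gt1 h2)) tu'.
have [c1 [t1 p1 s1]] := sort_last_letter n_gt1 c hu.
have ed : cols (u ++ [:: c1]) = map Posz d.
  apply: (@sorted_eq int (fun a a' : int => a' <= a)).
  - by move=> a a' a'' /= h5 h6; apply: le_trans h6 h5.
  - by move=> a a' /= /le_anti.
  - apply/(sortedP 0) => k; rewrite size_map size_iota => kn.
    by rewrite !(nth_map 0%N) ?size_iota ?nth_iota ?add0n //; [apply: s1|lia..].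
  - apply/(sortedP 0) => k; rewrite size_map sd => kn.
    rewrite !(nth_map 0%N) ?sd //; last by lia.
    by have := d1 k; rewrite mem_iota => /(_ ltac:(lia)); lia.
  by apply: perm_trans p1 _; rewrite perm_sym.
have cE k : (k < n)%N -> (nth 0%N d k)%:Z = colsum (u ++ [:: c1]) k.
  move=> kn; have := congr1 (fun s => nth 0 s k) ed.
  by rewrite !(nth_map 0%N) ?size_iota ?sd // nth_iota.
have hc1 : hw (u ++ [:: c1]).
  apply/(hw_hgt n_gt1) => i k; rewrite size_cat addn1 leq_eqVlt => /orP[/eqP ->|ku].
    rewrite -(addn1 (size u)) -(size_cat u [:: c1]) hgt_size.
    apply: (tot_ge0_col n_gt1 _).2; split=> //.
    by rewrite -!cE ?size_cat ?addn1 //; lia.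
  by rewrite hgt_cat -ltnS ku; apply: (hw_hgt n_gt1 u).1.
have eT1 : top (u' ++ [:: c]) = u ++ [:: c1] by rewrite eT -t1 top_id.
rewrite eT1 -!catA /= in e1 h3 h4.
exists c1, c2; split=> //; exact: diag_eq.
Qed.

End Tableaux.

(** [SSSYT] imposes the strip condition only between listed diagrams; for the first diagram over the
    empty one it comes from shortness at length one. *)
Lemma SYD1_le1 n (d : diagram) c : SYD 1 n d -> (c < n)%N -> (nth 0 d c <= 1)%N.
Proof.
case/and3P=> _ /allP h1 h2; elim: c => [|c IH] cn; first by lia.
by have := h1 c; rewrite mem_iota => /(_ ltac:(lia)); have := IH (ltnW cn); lia.
Qed.

Local Close Scope ring_scope.

Theorem theoremA (n N i : nat) (nu : seq nat) (x : seq (seq nat))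
    (w : seq (seq bool)) :
  2 <= n -> 2 <= N -> 1 <= i <= N.-1 ->
  SYD N n nu -> SSSYT n nu N x ->
  TN n N w -> tab n w = x ->
  SSSYT n nu N (bk n i x) ->
  TN n N (T n i w) /\ tab n (T n i w) = bk n i x.
Proof.
move=> n_gt1 N_gt1 /andP[i0 iN] _ /and4P[/eqP sx /allP xS /allP xH _] tN tx bkS.
have [w' sw' ew] : exists2 w' : seq (letter n), size w' = N & w = raw w'.
  by apply/(validP n N w); case/andP: tN.
subst w; have [_ hw'] := (TN_raw n_gt1 N w').1 tN.
have [u [b [c [r [ew su]]]]] : exists u b c r, w' = u ++ [:: b, c & r] /\ size u = i.-1.
  exists (take i.-1 w'), (nth (l0 n) w' i.-1), (nth (l0 n) w' i), (drop i.+1 w').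
  rewrite size_takel; last by lia.
  split=> //; rewrite -[LHS](cat_take_drop i.-1); congr (_ ++ _).
  rewrite (drop_nth (l0 n)) ?prednK //; last by lia.
  by rewrite (drop_nth (l0 n)) //; lia.
have ei : i = (size u).+1 by lia.
have xE k : k < N -> nth [::] x k = diag_of n (raw (take k.+1 w')).
  move=> kN; rewrite -tx /tab (nth_map 0) ?size_iota ?size_raw ?sw' //.
  by rewrite nth_iota ?size_raw ?sw' // /raw -map_take.
have XE k a : k < N -> a < n -> Posz (nth 0 (nth [::] x k) a) = colsum (take k.+1 w') a.
  by move=> kN an; rewrite xE // diag_nth.
have hubc : hw (u ++ [:: b; c]).
  by apply: (@hw_catl n n_gt1 _ r); rewrite -catA /= -ew.
set d := new_diag n i x.
have Sd : SYD (size u).+1 n d.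
  case/and4P: bkS => _ /allP /(_ i.-1) h _ _; move: h.
  rewrite mem_iota /bk nth_set_nth /= eqxx su => /(_ ltac:(lia)).
  by rewrite prednK.
have pd : perm_eq (map Posz d) (cols (u ++ [:: c])).
  have il : i < size x by rewrite sx; lia.
  have X0 a : a < n -> nth 0 (nth [::] x 0) a <= 1.
    by move=> an; apply: (SYD1_le1 _ an); apply: xS; rewrite mem_iota; lia.
  have XS k a : k.+1 < size x -> a < n ->
      nth 0 (nth [::] x k) a <= nth 0 (nth [::] x k.+1) a <= (nth 0 (nth [::] x k) a).+1.
    rewrite sx => kx an; have := xH k; rewrite mem_iota => /(_ ltac:(lia)) /allP /(_ a).
    by rewrite mem_iota; apply.
  apply: perm_trans (perm_map _ (perm_new_diag i0 il X0 XS)) _.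
  rewrite -map_comp (_ : map _ _ = cols (u ++ [:: c])) //.
  (* [K + V - M] describes the path that takes the step [c] directly after [u]: the strip from [M]
     to [V] is put on top of [K]. *)
  apply/eq_in_map => a; rewrite mem_iota /= add0n => an.
  have Ka : Posz (if i == 1 then 0 else nth 0 (nth [::] x (i - 2)) a) = colsum u a.
    case: (eqVneq i 1) => [e1|i1].
      have -> : u = [::] by apply: size0nil; lia.
      by rewrite /colsum big_nil.
    rewrite XE //; last by lia.
    have -> : (i - 2).+1 = size u by lia.
    by rewrite ew take_size_cat.
  have Ma : Posz (nth 0 (nth [::] x (i - 1)) a) = colsum (u ++ [:: b]) a.
    rewrite XE //; last by lia.
    have -> : (i - 1).+1 = size (u ++ [:: b]) by rewrite size_cat /=; lia.
    have -> : w' = (u ++ [:: b]) ++ c :: r by rewrite ew -catA.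
    by rewrite take_size_cat.
  have Va : Posz (nth 0 (nth [::] x i) a) = colsum (u ++ [:: b; c]) a.
    rewrite XE //; last by lia.
    have -> : i.+1 = size (u ++ [:: b; c]) by rewrite size_cat /=; lia.
    have -> : w' = (u ++ [:: b; c]) ++ r by rewrite ew -catA.
    by rewrite take_size_cat.
  have := XS (i - 1) a; have -> : (i - 1).+1 = i by lia.
  move=> /(_ il an); move: Ka Ma Va.
  rewrite -(cat1s b [:: c]) !colsum_cat; lia.
have [c1 [c2 [e1 e2 h1 h2]]] := bk_op_sorted n_gt1 r hubc Sd pd.
have eT : T n i (raw w') = raw (u ++ [:: c1, c2 & r]).
  by rewrite T_raw ?sw' //; [rewrite ew ei e1|lia].
have hT : hw (u ++ [:: c1, c2 & r]).
  have -> : u ++ [:: c1, c2 & r] = (u ++ [:: c1; c2]) ++ r by rewrite -catA.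
  apply: (@hw_cat_subst n n_gt1 (u ++ [:: b; c])) => //.
  - by rewrite !size_cat.
  - by apply: tot_pl_eq => //; rewrite !size_cat.
  by rewrite -catA /= -ew.
have sT : size (u ++ [:: c1, c2 & r]) = N by rewrite -sw' ew !size_cat.
rewrite eT; split; first by apply/TN_raw.
have sbk : size (bk n i x) = N by case/and4P: bkS => /eqP.
apply: (@eq_from_nth _ [::]) => [|k].
  by rewrite sbk /tab size_map size_iota size_raw.
rewrite size_map size_iota size_raw sT => kN.
rewrite (nth_map 0) ?size_iota ?size_raw ?sT // nth_iota ?size_raw ?sT //.
rewrite /raw -map_take /bk nth_set_nth /=.
case: eqP => [->|/eqP ki].
  rewrite -/d -e2; congr (diag_of n (raw _)).
  have -> : 1 + i.-1 = size (u ++ [:: c1]) by rewrite size_cat /=; lia.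
  have -> : u ++ [:: c1, c2 & r] = (u ++ [:: c1]) ++ c2 :: r by rewrite -catA.
  by rewrite take_size_cat.
rewrite xE // add1n.
case: (ltnP k i) => ik.
  have ku : k.+1 <= size u by lia.
  by rewrite -[map _ _]/(raw _) ew !takel_cat.
(* From step [i + 1] on a diagram depends only on the weight of the prefix, and [c1], [c2] together
   weigh as much as [b], [c]. *)
apply: (diag_eq n_gt1); first by rewrite size_diag.
move=> a an; rewrite diag_nth //.
have -> : w' = (u ++ [:: b; c]) ++ r by rewrite ew -catA.
have -> : u ++ [:: c1, c2 & r] = (u ++ [:: c1; c2]) ++ r by rewrite -catA.
have s1 : size (u ++ [:: b; c]) = i.+1 by rewrite size_cat /=; lia.
have s2 : size (u ++ [:: c1; c2]) = i.+1 by rewrite size_cat /=; lia.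
have ki' : (k.+1 < i.+1) = false by lia.
rewrite !take_cat s1 s2 ki'.
rewrite [LHS]colsum_cat [RHS]colsum_cat; congr (_ + _)%R.
rewrite !colsum_pl // s1 s2; case: ifP => _; rewrite h2 //; lia.
Qed.
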